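(* Let $d\ge 2$, $n\ge 1$, $\beta\in\mathbb{R}$, and let $Q,K$ be arbitrary real $d\times d$ matrices. Consider the causal self-attention dynamics with value matrix $V=I_d$, i.e. the system of ODEs on $(\mathbb{S}^{d-1})^n$ \[ \dot{x}_{k}(t) = \mathbf{P}_{x_{k}(t)}\Big(\frac{1}{Z_{k}(t)} \sum_{j=1}^k e^{\beta \langle Q x_{k}(t), K x_{j}(t)\rangle} x_{j}(t)\Big),\qquad Z_{k}(t) = \sum_{j=1}^k e^{\beta \langle Q x_{k}(t), K x_{j}(t)\rangle},\qquad k=1,\dots,n . \] Then for almost every initial condition $(x_1(0),\ldots,x_n(0))\in(\mathbb{S}^{d-1})^n$, with respect to the volume measure on $(\mathbb{S}^{d-1})^n$, the solution converges to a single cluster: \[ \forall\, k\in\{1,\dots,n\},\quad \lim_{t\to\infty} x_k(t) = x_1(0). \]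
   Context: $\mathbb{S}^{d-1}$ is the unit sphere of $\mathbb{R}^d$ and $\langle\cdot,\cdot\rangle$ is the Euclidean inner product. For $x\neq 0$, $\mathbf{P}_x y = y-\frac{\langle x,y\rangle x}{|x|^2}$ is the orthogonal projection of $y$ onto the hyperplane $x^\perp$ (for $x\in\mathbb{S}^{d-1}$, the tangent space of the sphere at $x$). The volume measure on $(\mathbb{S}^{d-1})^n$ is the product of the surface measures. *)

(* Defs.v *)
From HB Require Import structures.
From mathcomp Require Import all_boot all_order all_algebra.
From mathcomp Require Import all_classical all_reals all_analysis.
From mathcomp Require Import measurable_realfun.
Set Implicit Arguments.
Unset Strict Implicit.
Unset Printing Implicit Defensive.
Import Order.TTheory GRing.Theory Num.Theory.
Import numFieldNormedType.Exports.
Local Open Scope classical_set_scope.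
Local Open Scope ring_scope.

(** Euclidean geometry of R^d. The norm [`|x|] of the normedModType ['cV[R]_d]
    is the sup norm; it induces the usual topology, but lengths have to be
    measured with [enorm]. *)

Section euclidean.
Context {R : realType} {d : nat}.
Implicit Types x y : 'cV[R]_d.

Definition edot x y : R := \sum_(i < d) x i 0 * y i 0.

Definition enorm x : R := Num.sqrt (edot x x).

Definition usphere : set 'cV[R]_d := [set x | enorm x = 1].

Definition proj_perp x y : 'cV[R]_d := y - (edot x y / enorm x ^+ 2) *: x.

End euclidean.

(** Causal self-attention with value matrix the identity. Tokens are indexed
    from 0, so the sums over [j <= k] include [j = k]. *)

Section causal_attention.
Context {R : realType} {d n : nat}.
Variables (beta : R) (Q K : 'M[R]_d).
Implicit Types (x : 'I_n -> 'cV[R]_d) (k : 'I_n).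

Definition attn_weight (u v : 'cV[R]_d) : R :=
  expR (beta * edot (Q *m u) (K *m v)).

Definition attn_partition x k : R :=
  \sum_(j < n | (j <= k)%N) attn_weight (x k) (x j).

Definition causal_field x k : 'cV[R]_d :=
  proj_perp (x k)
    ((attn_partition x k)^-1 *:
       \sum_(j < n | (j <= k)%N) attn_weight (x k) (x j) *: x j).

(* Classical solution on the time interval [0, +oo[; at [t = 0] the equation
   holds for the right derivative, as a consequence of the three clauses. *)
Definition causal_solution (x : 'I_n -> R -> 'cV[R]_d) : Prop :=
  [/\ forall k (t : R), 0 <= t -> usphere (x k t),
      forall k, {within `[0, +oo[, continuous (x k)} &
      forall k (t : R), 0 < t -> is_derive t 1 (x k) (causal_field (x ^~ t) k)].

End causal_attention.

(** Finite powers of a sigma-finite measure, on the product sigma-algebra of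
    [n.-tuple T]. *)

Section tuple_measure.
Context d (T : measurableType d) (R : realType).

Definition tuple_cons n (p : T * n.-tuple T) : n.+1.-tuple T :=
  [tuple of p.1 :: p.2].

Definition tuple_uncons n (t : n.+1.-tuple T) : T * n.-tuple T :=
  (thead t, [tuple of behead t]).

Lemma tuple_consK n : cancel (@tuple_cons n) (@tuple_uncons n).
Proof. by move=> [x t]; congr pair; apply/val_inj. Qed.

Lemma measurable_tuple_cons n : measurable_fun setT (@tuple_cons n).
Proof. exact: measurable_cons. Qed.

Lemma measurable_tuple_uncons n : measurable_fun setT (@tuple_uncons n).
Proof.
apply: measurable_fun_pair => /=.
- exact: measurable_tnth.
- exact: measurable_behead.
Qed.

Section cons.
Variables (mu : {sigma_finite_measure set T -> \bar R}) (n : nat)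
  (nu : {sigma_finite_measure set (n.-tuple T) -> \bar R}).

Definition cons_measure : set (n.+1.-tuple T) -> \bar R :=
  pushforward (mu \x nu)%E (@tuple_cons n).

Let cons_measure0 : cons_measure set0 = 0%E.
Proof. by rewrite /cons_measure /pushforward preimage_set0 measure0. Qed.

Let cons_measure_ge0 A : (0 <= cons_measure A)%E.
Proof. by apply: measure_ge0; exact: measurable_tuple_cons. Qed.

Let cons_measure_sigma_additive : semi_sigma_additive cons_measure.
Proof.
apply: measure_semi_sigma_additive; exact: measurable_tuple_cons.
Qed.

HB.instance Definition _ := isMeasure.Build _ _ _ cons_measure
  cons_measure0 cons_measure_ge0 cons_measure_sigma_additive.

Let cons_measure_sigma_finite : sigma_finite setT cons_measure.
Proof.
have /sigma_finiteP[F [TF ndF Foo]] := sigma_finiteT mu.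
have /sigma_finiteP[G [TG ndG Goo]] := sigma_finiteT nu.
exists (fun i => @tuple_uncons n @^-1` (F i `*` G i)).
  apply/esym/seteqP; split=> // t _.
  have [i _ Fi] : (\bigcup_k F k) (tuple_uncons t).1 by rewrite -TF.
  have [j _ Gj] : (\bigcup_k G k) (tuple_uncons t).2 by rewrite -TG.
  exists (maxn i j) => //; split.
  - by move: Fi; exact/subsetPset/ndF/leq_maxl.
  - by move: Gj; exact/subsetPset/ndG/leq_maxr.
move=> k; have [mF Fk] := Foo k; have [mG Gk] := Goo k; split.
  rewrite -[X in measurable X]setTI.
  by apply: measurable_tuple_uncons => //; exact: measurableX.
rewrite /cons_measure /pushforward -comp_preimage.
rewrite (_ : @tuple_uncons n \o _ = id); last first.
  by apply/funext => p /=; exact: tuple_consK.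
by rewrite preimage_id product_measure1E// lte_mul_pinfty// ge0_fin_numE.
Qed.

HB.instance Definition _ := @Measure_isSigmaFinite.Build _ _ _ cons_measure
  cons_measure_sigma_finite.

End cons.

Fixpoint tuple_measure (mu : {sigma_finite_measure set T -> \bar R}) n :
    {sigma_finite_measure set (n.-tuple T) -> \bar R} :=
  if n is n'.+1 then cons_measure mu (tuple_measure mu n')
  else dirac [tuple].

Lemma measurable_tuple_box n (A : 'I_n -> set T) :
  (forall i, measurable (A i)) ->
  measurable [set t : n.-tuple T | forall i, A i (tnth t i)].
Proof.
move=> mA; rewrite (_ : [set _ | _] =
    \big[setI/setT]_(i < n) ((fun t : n.-tuple T => tnth t i) @^-1` A i)).
  apply: bigsetI_measurable => i _; rewrite -[X in measurable X]setTI.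
  exact: measurable_tnth.
rewrite -bigcap_seq; apply/seteqP; split=> [t At i _|t At i]; first exact: At.
by apply: At => /=; rewrite mem_index_enum.
Qed.

Lemma tuple_measureE (mu : {sigma_finite_measure set T -> \bar R}) n
    (A : 'I_n -> set T) : (forall i, measurable (A i)) ->
  tuple_measure mu n [set t | forall i, A i (tnth t i)] =
  (\prod_(i < n) mu (A i))%E.
Proof.
elim: n A => [|n IH] A mA /=.
  by rewrite big_ord0 diracE mem_set// => -[].
rewrite big_ord_recl -(IH (A \o lift ord0)); last by move=> i; exact: mA.
rewrite -product_measure1E//; last first.
  by apply: (@measurable_tuple_box n (A \o lift ord0)) => i; exact: mA.
rewrite /cons_measure /pushforward; congr product_measure1.
apply/seteqP; split=> -[x t] /=.
- move=> At; split=> [|i]; first exact: (At ord0).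
  by have := At (lift ord0 i); rewrite /tuple_cons tnthS.
- move=> [Ax At] i; have [j ->|->//] := unliftP ord0 i.
  by have := At j; rewrite /tuple_cons tnthS.
Qed.

End tuple_measure.

Section sphere_measure.
Context {R : realType} {d : nat}.
Local Notation T := (d.-tuple (measurableTypeR R)).
Implicit Type t : T.

Definition tuple_col t : 'cV[R]_d := \col_i tnth t i.

Definition lebesgue_tuple : {sigma_finite_measure set T -> \bar R} :=
  tuple_measure (@lebesgue_measure R) d.

Definition unit_ball_tuple : set T := [set t | 0 < enorm (tuple_col t) <= 1].

Definition tuple_normalize t : T :=
  [tuple tnth t i / enorm (tuple_col t) | i < d].

Lemma measurable_enorm_tuple_col :
  measurable_fun setT (fun t => enorm (tuple_col t)).
Proof.
rewrite (_ : (fun t => _) =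
    Num.sqrt \o (fun t => \sum_(i < d) tnth t i * tnth t i)); last first.
  apply/funext => t /=; rewrite /enorm /edot; congr Num.sqrt.
  by apply: eq_bigr => i _; rewrite !mxE.
apply: measurableT_comp.
  apply: continuous_measurable_fun; exact: sqrt_continuous.
by apply: measurable_sum => i; apply: measurable_funM; exact: measurable_tnth.
Qed.

Lemma measurable_unit_ball_tuple : measurable unit_ball_tuple.
Proof.
rewrite (_ : unit_ball_tuple =
    (fun t => enorm (tuple_col t)) @^-1` `]0, 1]%classic); last first.
  by apply/seteqP; split=> t; rewrite /unit_ball_tuple /= in_itv.
by rewrite -[X in measurable X]setTI; exact: measurable_enorm_tuple_col.
Qed.

Lemma measurable_tuple_normalize : measurable_fun setT tuple_normalize.
Proof.
apply/measurable_fun_tnthP => i.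
rewrite (_ : _ \o _ =
    fun t => tnth t i * (enorm (tuple_col t) `^ (- 1))); last first.
  apply/funext => t /=; rewrite tnth_mktuple powR_inv1 //; exact: sqrtr_ge0.
apply: measurable_funM; first exact: measurable_tnth.
apply: (measurableT_comp (measurable_powR _)).
exact: measurable_enorm_tuple_col.
Qed.

Lemma lebesgue_unit_ball_tuple : (lebesgue_tuple unit_ball_tuple < +oo)%E.
Proof.
pose B := [set t : T | forall i, `[-1, 1]%classic (tnth t i)].
have mB : measurable B.
  apply: (@measurable_tuple_box _ (measurableTypeR R) d
    (fun=> `[-1, 1]%classic)) => i.
  exact: measurable_itv.
apply: (@le_lt_trans _ _ (lebesgue_tuple B)).
  apply: le_measure; rewrite ?inE//; first exact: measurable_unit_ball_tuple.
  move=> t /andP[_ t1] i; rewrite /= in_itv /= -ler_norml.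
  apply: le_trans t1; rewrite -sqrtr_sqr; apply: ler_wsqrtr.
  rewrite /edot (bigD1 i)//= mxE -expr2 lerDl.
  by apply: sumr_ge0 => j _; rewrite -expr2 sqr_ge0.
rewrite (@tuple_measureE _ (measurableTypeR R) R _ d
  (fun=> `[-1, 1]%classic)); last by move=> i; exact: measurable_itv.
rewrite -ge0_fin_numE; last by apply: prode_ge0 => i _; exact: measure_ge0.
apply: prode_fin_num => i _.
by rewrite [X in X \is a _](lebesgue_measure_itv `[-1, 1]) /=; case: ifP.
Qed.

(* Polar coordinates: the surface measure of [A] is [d] times the volume of the
   cone over [A], that is of the set of the [v] in the unit ball, [v != 0], such
   that [v / |v|] is in [A]. It is a measure on the ambient space, concentrated
   on the unit sphere. *)
Definition sphere_measure : set T -> \bar R :=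
  pushforward
    (mscale d%:R%:nng
       (mfrestr measurable_unit_ball_tuple lebesgue_unit_ball_tuple))
    tuple_normalize.

Let sphere_measure0 : sphere_measure set0 = 0%E.
Proof. by rewrite /sphere_measure /pushforward preimage_set0 measure0. Qed.

Let sphere_measure_ge0 A : (0 <= sphere_measure A)%E.
Proof. by apply: measure_ge0; exact: measurable_tuple_normalize. Qed.

Let sphere_measure_sigma_additive : semi_sigma_additive sphere_measure.
Proof.
by apply: measure_semi_sigma_additive; exact: measurable_tuple_normalize.
Qed.

HB.instance Definition _ := isMeasure.Build _ _ _ sphere_measure
  sphere_measure0 sphere_measure_ge0 sphere_measure_sigma_additive.

Let sphere_measure_finite : fin_num_fun sphere_measure.
Proof.
move=> A mA; apply: fin_num_measure; rewrite -[X in measurable X]setTI.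
exact: measurable_tuple_normalize.
Qed.

HB.instance Definition _ := @Measure_isFinite.Build _ _ _ sphere_measure
  sphere_measure_finite.

Definition sphere_volume n :
    {sigma_finite_measure set (n.-tuple T) -> \bar R} :=
  tuple_measure sphere_measure n.

Lemma enorm_tuple_normalize t : unit_ball_tuple t ->
  usphere (tuple_col (tuple_normalize t)).
Proof.
move=> /andP[t0 _]; rewrite /usphere /=.
have -> : tuple_col (tuple_normalize t) =
    (enorm (tuple_col t))^-1 *: tuple_col t.
  by apply/colP => i; rewrite !mxE tnth_mktuple mulrC.
set e := enorm _ in t0 *.
have edotZ : edot (e^-1 *: tuple_col t) (e^-1 *: tuple_col t) =
    e ^- 2 * edot (tuple_col t) (tuple_col t).
  rewrite /edot mulr_sumr; apply: eq_bigr => i _.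
  by rewrite !mxE mulrACA -expr2 exprVn.
rewrite /enorm edotZ sqrtrM ?invr_ge0 ?sqr_ge0// -/(enorm _) -/e.
by rewrite -exprVn sqrtr_sqr ger0_norm ?invr_ge0 ?ltW// mulVf ?gt_eqF.
Qed.

Lemma sphere_measure_concentrated :
  sphere_measure [set t | ~ usphere (tuple_col t)] = 0%E.
Proof.
have E : tuple_normalize @^-1` [set t | ~ usphere (tuple_col t)] `&`
    unit_ball_tuple = set0.
  by apply/seteqP; split=> // t [/= + Bt]; apply; exact: enorm_tuple_normalize.
by rewrite /sphere_measure /pushforward /= /mscale /= /mfrestr /mrestr E
  measure0 mule0.
Qed.

End sphere_measure.

(* Main.v *)
(** The first token never moves; call it [u]. If the previous tokens converge to
    [u], then the k-th token eventually follows a perturbed, time-changed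
    gradient flow of [<u, .>] on the sphere, so it converges to [u] or to [- u].
    The antipode [- u] is repelling in every direction: two solutions whose k-th
    tokens both stay near it separate exponentially, up to the distance of their
    previous tokens. Hence, among the initial data for which the k-th token stays
    near the antipode from time [T] on, its position is a uniformly continuous
    function of the positions of the previous tokens. By Fubini the graph of such
    a function is null, without any measurability of this set nor any existence
    or regularity result on the flow. *)

Require Import Defs.
From mathcomp Require Import all_boot all_order all_algebra.
From mathcomp Require Import all_classical all_reals all_analysis.
From mathcomp Require Import ring lra.
Import Order.TTheory GRing.Theory Num.Theory.
Import numFieldNormedType.Exports.
Local Open Scope classical_set_scope.
Local Open Scope ring_scope.

(** * Euclidean geometry and the attention field *)

Section edot_theory.
Context {R : realType} {d : nat}.
Implicit Types x y z : 'cV[R]_d.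

Lemma edotC x y : edot x y = edot y x.
Proof. by apply: eq_bigr => i _; rewrite mulrC. Qed.

Lemma edotDr x y z : edot x (y + z) = edot x y + edot x z.
Proof. by rewrite -big_split; apply: eq_bigr => i _; rewrite mxE mulrDr. Qed.

Lemma edotZr a x y : edot x (a *: y) = a * edot x y.
Proof. by rewrite mulr_sumr; apply: eq_bigr => i _; rewrite mxE mulrCA. Qed.

Lemma edotDl x y z : edot (x + y) z = edot x z + edot y z.
Proof. by rewrite edotC edotDr !(edotC z). Qed.

Lemma edotZl a x y : edot (a *: x) y = a * edot x y.
Proof. by rewrite edotC edotZr edotC. Qed.

Lemma edotNr x y : edot x (- y) = - edot x y.
Proof. by rewrite -scaleN1r edotZr mulN1r. Qed.

Lemma edotNl x y : edot (- x) y = - edot x y.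
Proof. by rewrite edotC edotNr edotC. Qed.

Lemma edotBr x y z : edot x (y - z) = edot x y - edot x z.
Proof. by rewrite edotDr edotNr. Qed.

Lemma edotBl x y z : edot (x - y) z = edot x z - edot y z.
Proof. by rewrite edotDl edotNl. Qed.

Lemma edot_sumr x (I : Type) (r : seq I) (P : pred I) (F : I -> 'cV[R]_d) :
  edot x (\sum_(i <- r | P i) F i) = \sum_(i <- r | P i) edot x (F i).
Proof.
apply: (big_morph (edot x)) => [y z|]; first exact: edotDr.
by rewrite -[0](scale0r 0) edotZr mul0r.
Qed.

Lemma edot_ge0 x : 0 <= edot x x.
Proof. by apply: sumr_ge0 => i _; rewrite -expr2 sqr_ge0. Qed.

Lemma edot_eq0 x : edot x x = 0 -> x = 0.
Proof.
move=> /eqP; rewrite psumr_eq0 => [/allP x0|i _]; last by rewrite -expr2 sqr_ge0.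
apply/colP => i; rewrite mxE; apply/eqP.
by have := x0 i; rewrite mem_index_enum mulf_eq0 orbb => /(_ isT).
Qed.

Lemma enorm_ge0 x : 0 <= enorm x.
Proof. exact: sqrtr_ge0. Qed.

Lemma sqr_enorm x : enorm x ^+ 2 = edot x x.
Proof. by rewrite sqr_sqrtr// edot_ge0. Qed.

Lemma enormZ a x : enorm (a *: x) = `|a| * enorm x.
Proof. by rewrite /enorm edotZl edotZr mulrA -expr2 sqrtrM ?sqr_ge0// sqrtr_sqr. Qed.

Lemma enormN x : enorm (- x) = enorm x.
Proof. by rewrite /enorm edotNl edotNr opprK. Qed.

Lemma enorm_distC x y : enorm (x - y) = enorm (y - x).
Proof. by rewrite -enormN opprB. Qed.

(** Cauchy-Schwarz: the squared norm of [edot y y *: x - edot x y *: y] is [edot y y] times the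
    defect of the squared inequality. *)
Lemma edot_le x y : `|edot x y| <= enorm x * enorm y.
Proof.
rewrite -(@ler_pXn2r _ 2)// ?nnegrE ?mulr_ge0 ?enorm_ge0//.
rewrite real_normK ?num_real// exprMn !sqr_enorm.
have [/edot_eq0->|y0] := eqVneq (edot y y) 0.
  by rewrite -[0](scale0r (0 : 'cV[R]_d)) !edotZr !mul0r expr0n mulr0.
have yp : 0 < edot y y by rewrite lt_def y0 edot_ge0.
have := edot_ge0 (edot y y *: x - edot x y *: y).
rewrite edotBl !edotBr !edotZl !edotZr (edotC y x) => H.
rewrite -subr_ge0 -(pmulr_rge0 _ yp); apply: le_trans H _; rewrite le_eqVlt.
by apply/orP; left; apply/eqP; ring.
Qed.

Lemma enormD x y : enorm (x + y) <= enorm x + enorm y.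
Proof.
rewrite -(@ler_pXn2r _ 2)// ?nnegrE ?addr_ge0 ?enorm_ge0//.
rewrite sqr_enorm edotDl !edotDr (edotC y x) sqrrD !sqr_enorm.
have := edot_le x y; rewrite ler_norml => /andP[_ ?]; lra.
Qed.

Lemma enorm0 : enorm (0 : 'cV[R]_d) = 0.
Proof. by rewrite -(scale0r 0) enormZ normr0 mul0r. Qed.

Lemma enorm_sum (I : Type) (r : seq I) (P : pred I) (F : I -> 'cV[R]_d) :
  enorm (\sum_(i <- r | P i) F i) <= \sum_(i <- r | P i) enorm (F i).
Proof.
elim/big_rec2: _ => [|i a x _ xa]; first by rewrite enorm0.
by apply: le_trans (enormD _ _) _; rewrite lerD2l.
Qed.

Lemma coord_le_enorm x i : `|x i 0| <= enorm x.
Proof.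
rewrite -sqrtr_sqr; apply: ler_wsqrtr.
rewrite /edot (bigD1 i)//= -expr2 lerDl.
by apply: sumr_ge0 => j _; rewrite -expr2 sqr_ge0.
Qed.

Lemma edot_dist x y : usphere x -> usphere y ->
  edot x y = 1 - enorm (x - y) ^+ 2 / 2.
Proof.
move=> x1 y1; rewrite sqr_enorm edotBl !edotBr (edotC y x) -!sqr_enorm x1 y1.
by lra.
Qed.

Lemma edot_antidist x y : usphere x -> usphere y ->
  edot x y = enorm (x + y) ^+ 2 / 2 - 1.
Proof.
move=> x1 y1; rewrite sqr_enorm edotDl !edotDr (edotC y x) -!sqr_enorm x1 y1.
by lra.
Qed.

Lemma usphere_dist_le2 x y : usphere x -> usphere y -> enorm (x - y) <= 2.
Proof.
by move=> x1 y1; apply: le_trans (enormD _ _) _; rewrite enormN x1 y1.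
Qed.

(** Expand [A *m x] along the columns of [A]: each coordinate of [x] is at most [enorm x], so the
    sum of the column norms bounds the operator. *)
Lemma mulmx_enorm_bounded (A : 'M[R]_d) :
  exists2 q, 0 <= q & forall x, enorm (A *m x) <= q * enorm x.
Proof.
exists (\sum_j enorm (col j A)) => [|x].
  by apply: sumr_ge0 => j _; exact: enorm_ge0.
have -> : A *m x = \sum_j x j 0 *: col j A.
  apply/colP => i; rewrite mxE summxE; apply: eq_bigr => j _.
  by rewrite !mxE mulrC.
apply: le_trans (enorm_sum _ _ _ _) _; rewrite mulr_suml; apply: ler_sum => j _.
by rewrite enormZ mulrC ler_wpM2l ?enorm_ge0// coord_le_enorm.
Qed.

End edot_theory.

Lemma expR_lipschitz {R : realType} (M a b : R) : a <= M -> b <= M ->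
  `|expR a - expR b| <= expR M * `|a - b|.
Proof.
wlog ab : a b / b <= a => [H aM bM|aM bM].
  have [|/ltW] := leP b a; first by move/H; apply.
  by move/H; rewrite distrC (distrC a); apply.
rewrite !ger0_norm ?subr_ge0 ?ler_expR//.
apply: (@le_trans _ _ (expR a * (a - b))).
  have -> : expR b = expR a * expR (b - a) by rewrite -expRD addrC subrK.
  have := expR_ge1Dx (b - a); have := expR_gt0 a; nra.
by apply: ler_wpM2r; rewrite ?subr_ge0 ?ler_expR.
Qed.

Lemma ler_sum_const {R : numDomainType} n (P : pred 'I_n) (F : 'I_n -> R) C :
  0 <= C -> (forall i, P i -> F i <= C) -> \sum_(i | P i) F i <= n%:R * C.
Proof.
move=> C0 FC; apply: (@le_trans _ _ (\sum_(i < n) C)); last first.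
  by rewrite sumr_const card_ord mulr_natl.
by rewrite big_mkcond; apply: ler_sum => i _; case: ifP => // /FC.
Qed.

(** * Bounds on the attention coefficients and on the field *)

Section attention_field.
Context {R : realType} {d n : nat}.
Variables (beta : R) (Q K : 'M[R]_d).
Implicit Types (X Y : 'I_n -> 'cV[R]_d) (i j k : 'I_n).

Local Notation weight := (attn_weight beta Q K).
Local Notation partition := (attn_partition beta Q K).
Local Notation field := (causal_field beta Q K).
Local Notation on_sphere X := (forall k, usphere (X k)).

(** The score is bilinear, so on unit vectors [|beta|] times the two operator bounds is at once a
    bound and a Lipschitz constant. *)
Lemma score_bounds : exists2 lam : R, 0 <= lam &
  forall u v u' v' : 'cV[R]_d, usphere u -> usphere v -> usphere u' -> usphere v' ->
    `|beta * edot (Q *m u) (K *m v)| <= lam /\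
    `|beta * edot (Q *m u) (K *m v) - beta * edot (Q *m u') (K *m v')|
      <= lam * (enorm (u - u') + enorm (v - v')).
Proof.
have [q q0 qP] := mulmx_enorm_bounded Q; have [p p0 pP] := mulmx_enorm_bounded K.
have B x y : `|beta * edot (Q *m x) (K *m y)| <=
    `|beta| * (q * p) * (enorm x * enorm y).
  rewrite normrM -mulrA ler_wpM2l//; apply: le_trans (edot_le _ _) _.
  rewrite mulrACA; apply: ler_pM => //; exact: enorm_ge0.
exists (`|beta| * (q * p)) => [|u v u' v' u1 v1 u'1 v'1]; first by rewrite !mulr_ge0.
split; first by have := B u v; rewrite u1 v1 !mulr1.
have -> : beta * edot (Q *m u) (K *m v) - beta * edot (Q *m u') (K *m v') =
    beta * edot (Q *m (u - u')) (K *m v) + beta * edot (Q *m u') (K *m (v - v')).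
  by rewrite !mulmxBr edotBl edotBr; ring.
apply: le_trans (ler_normD _ _) _; rewrite mulrDr.
have := B (u - u') v; have := B u' (v - v'); rewrite v1 u'1 mulr1 mul1r.
by move=> ? ?; apply: lerD.
Qed.

(** The softmax coefficients, a probability vector on [j <= k]. For [j > k] the quotient is defined
    but is not a coefficient of the field. *)
Definition attn_coef X k j := weight (X k) (X j) / partition X k.

Lemma weight_gt0 u v : 0 < weight u v.
Proof. exact: expR_gt0. Qed.

Lemma weight_le_partition X k j : (j <= k)%N -> weight (X k) (X j) <= partition X k.
Proof.
move=> jk; rewrite /attn_partition (bigD1 j)//= lerDl.
by apply: sumr_ge0 => i _; exact/ltW/weight_gt0.
Qed.

Lemma partition_gt0 X k : 0 < partition X k.
Proof. exact: lt_le_trans (weight_gt0 _ _) (weight_le_partition _ _ k (leqnn _)). Qed.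

Lemma attn_coef_ge0 X k j : 0 <= attn_coef X k j.
Proof. by apply: divr_ge0; apply: ltW; [exact: weight_gt0|exact: partition_gt0]. Qed.

Lemma attn_coef_sum X k : \sum_(j < n | (j <= k)%N) attn_coef X k j = 1.
Proof. by rewrite -mulr_suml divff// gt_eqF// partition_gt0. Qed.

Lemma attn_coef_le1 X k j : (j <= k)%N -> attn_coef X k j <= 1.
Proof.
by move=> jk; rewrite ler_pdivrMr ?partition_gt0// mul1r weight_le_partition.
Qed.

Lemma attn_coef_sum_lt X k : \sum_(j < n | (j < k)%N) attn_coef X k j <= 1.
Proof.
rewrite -(attn_coef_sum X k) [leRHS](bigID (fun j : 'I_n => (j < k)%N)) /=.
rewrite [X in _ <= X + _](eq_bigl (fun j : 'I_n => (j < k)%N)) => [|j].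
  by rewrite lerDl; apply: sumr_ge0 => j _; exact: attn_coef_ge0.
by case: (ltnP j k) => [/ltnW ->|]; rewrite ?andbF.
Qed.

(** On the sphere all weights lie between two positive constants, so no earlier token ever loses its
    influence; this [c] drives both the attraction to [u] and the repulsion from [- u]. *)
Lemma attn_coef_bounds : exists2 c : R, 0 < c & exists2 L : R, 0 <= L &
  forall X Y k j, on_sphere X -> on_sphere Y -> (j <= k)%N ->
    c <= attn_coef X k j /\
    `|attn_coef X k j - attn_coef Y k j| <=
      L * \sum_(i < n | (i <= k)%N) enorm (X i - Y i).
Proof.
have [lam lam0 lamP] := score_bounds.
set M := expR lam; set m := expR (- lam).
have M0 : 0 < M by exact: expR_gt0.
have m0 : 0 < m by exact: expR_gt0.
have wb X : on_sphere X -> forall k j, m <= weight (X k) (X j) <= M.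
  move=> SX k j; have [+ _] := lamP _ _ _ _ (SX k) (SX j) (SX k) (SX j).
  by rewrite ler_norml !ler_expR.
have Zm X k : on_sphere X -> m <= partition X k.
  move=> SX; apply: le_trans (weight_le_partition X k k (leqnn _)).
  by have /andP[] := wb _ SX k k.
have ZM X k : on_sphere X -> partition X k <= n%:R * M.
  move=> SX; apply: ler_sum_const; first exact: ltW.
  by move=> i _; have /andP[] := wb _ SX k i.
(* [n.+1] in place of [n] keeps the constant positive even for [n = 0]. *)
exists (m / (n.+1%:R * M)); first by rewrite divr_gt0// mulr_gt0.
exists (2 * M * lam * n.+1%:R / m).
  by rewrite divr_ge0 ?mulr_ge0// ltW.
move=> X Y k j SX SY jk; set r := \sum_(i < n | _) _; split.
  apply: ler_pM; first exact: ltW; first by rewrite invr_ge0 ltW// mulr_gt0.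
    by have /andP[] := wb _ SX k j.
  rewrite lef_pV2 ?posrE ?partition_gt0// ?mulr_gt0//.
  apply: le_trans (ZM X k SX) _; rewrite ler_wpM2r ?ler_nat//; exact: ltW.
have xr i : (i <= k)%N -> enorm (X i - Y i) <= r.
  move=> ik; rewrite /r (bigD1 i)//= lerDl.
  by apply: sumr_ge0 => *; exact: enorm_ge0.
have r0 : 0 <= r by apply: le_trans (xr k (leqnn _)); exact: enorm_ge0.
have wd i : (i <= k)%N ->
    `|weight (X k) (X i) - weight (Y k) (Y i)| <= 2 * M * lam * r.
  move=> ik; have [/ler_normlW Sx H] := lamP _ _ _ _ (SX k) (SX i) (SY k) (SY i).
  have [/ler_normlW Sy _] := lamP _ _ _ _ (SY k) (SY i) (SX k) (SX i).
  apply: le_trans (expR_lipschitz _ _ _ Sx Sy) _.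
  have -> : 2 * M * lam * r = M * (lam * (r + r)) by ring.
  apply: ler_wpM2l; first exact: ltW.
  by apply: le_trans H _; apply: ler_wpM2l => //; apply: lerD; exact: xr.
have Zd : `|partition Y k - partition X k| <= n%:R * (2 * M * lam * r).
  rewrite distrC /attn_partition -sumrB; apply: le_trans (ler_norm_sum _ _ _) _.
  by apply: ler_sum_const => //; rewrite !mulr_ge0// ltW.
have ZX0 := partition_gt0 X k; have ZY0 := partition_gt0 Y k.
(* For weights [a], [a'] and partitions [Z], [Z']: [a / Z - a' / Z' = (a - a' + (a' / Z') * (Z' -
   Z)) / Z], where [a' / Z' <= 1]. *)
have -> : attn_coef X k j - attn_coef Y k j =
    (weight (X k) (X j) - weight (Y k) (Y j)
     + attn_coef Y k j * (partition Y k - partition X k)) / partition X k.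
  by rewrite /attn_coef; field; rewrite !gt_eqF.
rewrite normrM normfV (gtr0_norm ZX0).
have -> : 2 * M * lam * n.+1%:R / m * r =
    (2 * M * lam * r + n%:R * (2 * M * lam * r)) / m.
  by rewrite -natr1; field; rewrite gt_eqF.
apply: ler_pM => //; first by rewrite invr_ge0 ltW.
  apply: le_trans (ler_normD _ _) _; apply: lerD; first exact: wd.
  rewrite normrM ger0_norm ?attn_coef_ge0//; apply: le_trans Zd.
  by apply: ler_piMl => //; exact: attn_coef_le1.
by rewrite lef_pV2 ?posrE//; exact: Zm.
Qed.

(** The projection annihilates [X k], so the term [j = k] drops out and only strictly earlier tokens
    pull on token [k]. *)
Lemma edot_field X k z : on_sphere X -> edot z (field X k) =
  \sum_(j < n | (j < k)%N)
    attn_coef X k j * (edot z (X j) - edot (X k) (X j) * edot z (X k)).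
Proof.
move=> SX; rewrite /causal_field /proj_perp (SX k) expr1n divr1.
set v := _ *: _.
have vE y : edot y v = \sum_(j < n | (j <= k)%N) attn_coef X k j * edot y (X j).
  rewrite edotZr edot_sumr mulr_sumr; apply: eq_bigr => j _.
  by rewrite edotZr /attn_coef; ring.
rewrite edotBr edotZr !vE mulr_suml -sumrB (bigD1 k)//=.
rewrite -(sqr_enorm (X k)) (SX k) expr1n mulr1 subrr add0r.
by apply: eq_big => [j|j _]; [rewrite ltn_neqAle andbC|ring].
Qed.

Lemma field0 X k : on_sphere X -> k = 0 :> nat -> field X k = 0.
Proof.
by move=> SX k0; apply: edot_eq0; rewrite edot_field// k0 big_pred0.
Qed.

(** On the sphere [edot (X k - Y k) (X k)] and [- edot (X k - Y k) (Y k)] both equal half the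
    squared distance. Hence the projections contribute only the last, quadratic term, which is
    expanding where the inner products are negative. *)
Lemma edot_field_diff X Y k : on_sphere X -> on_sphere Y ->
  edot (X k - Y k) (field X k - field Y k) =
  \sum_(j < n | (j < k)%N)
    ((attn_coef X k j - attn_coef Y k j) * edot (X k - Y k) (X j)
     + attn_coef Y k j * edot (X k - Y k) (X j - Y j))
  - edot (X k - Y k) (X k - Y k) / 2 *
  \sum_(j < n | (j < k)%N) (attn_coef X k j * edot (X k) (X j)
                            + attn_coef Y k j * edot (Y k) (Y j)).
Proof.
move=> SX SY; rewrite edotBr !edot_field// -sumrB mulr_sumr -sumrB.
apply: eq_bigr => j _; rewrite !edotBl !edotBr (edotC (Y k) (X k)).
rewrite -(sqr_enorm (X k)) -(sqr_enorm (Y k)) (SX k) (SY k); by field.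
Qed.

(** Prepares Gronwall for squared distances of prefixes: causality keeps tokens after [k] out of the
    bound, and the absolute value gives estimates forward and backward in time. *)
Lemma field_one_sided_lipschitz : exists2 L : R, 0 <= L &
  forall X Y k, on_sphere X -> on_sphere Y ->
    `|edot (X k - Y k) (field X k - field Y k)| <=
      L * \sum_(j < n | (j <= k)%N) edot (X j - Y j) (X j - Y j).
Proof.
have [c c0 [L L0 cL]] := attn_coef_bounds.
exists ((n%:R * L + n%:R) * n%:R + 1) => [|X Y k SX SY].
  by rewrite addr_ge0// mulr_ge0// addr_ge0// mulr_ge0.
set G := \sum_(j < n | _) edot _ _.
set s := enorm (X k - Y k); set r := \sum_(j < n | (j <= k)%N) enorm (X j - Y j).
have s0 : 0 <= s by exact: enorm_ge0.
have jr j : (j <= k)%N -> enorm (X j - Y j) <= r.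
  move=> jk; rewrite /r (bigD1 j)//= lerDl.
  by apply: sumr_ge0 => *; exact: enorm_ge0.
have r0 : 0 <= r by apply: le_trans (jr k (leqnn _)).
have jG j : (j <= k)%N -> enorm (X j - Y j) ^+ 2 <= G.
  move=> jk; rewrite sqr_enorm /G (bigD1 j)//= lerDl.
  by apply: sumr_ge0 => *; exact: edot_ge0.
have sG : s ^+ 2 <= G := jG k (leqnn _).
have G0 : 0 <= G by apply: le_trans sG; exact: sqr_ge0.
(* Each product of two norms is at most the mean of their squares, hence at most [G]. *)
have rs : r * s <= n%:R * G.
  rewrite mulr_suml; apply: ler_sum_const => // j jk.
  have := jG j jk; have := sqr_ge0 (enorm (X j - Y j) - s); nra.
rewrite edot_field_diff// -sqr_enorm -/s; apply: le_trans (ler_normB _ _) _.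
have T1 : `|\sum_(j < n | (j < k)%N)
    ((attn_coef X k j - attn_coef Y k j) * edot (X k - Y k) (X j)
     + attn_coef Y k j * edot (X k - Y k) (X j - Y j))| <= n%:R * ((L + 1) * (r * s)).
  apply: le_trans (ler_norm_sum _ _ _) _; apply: ler_sum_const => [|j jk].
    by rewrite !mulr_ge0// addr_ge0.
  apply: le_trans (ler_normD _ _) _; rewrite [leRHS]mulrDl mul1r !(normrM _ (edot _ _)) mulrA.
  have [_ aL] := cL X Y k j SX SY (ltnW jk).
  apply: lerD.
    apply: ler_pM => //; apply: le_trans (edot_le _ _) _.
    by rewrite (SX j) mulr1.
  rewrite ger0_norm ?attn_coef_ge0//.
  apply: (@le_trans _ _ `|edot (X k - Y k) (X j - Y j)|).
    by apply: ler_piMl => //; apply: attn_coef_le1; exact: ltnW.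
  apply: le_trans (edot_le _ _) _; rewrite mulrC; apply: ler_wpM2r => //.
  by apply: jr; exact: ltnW.
(* Each of the two families of coefficients sums to at most 1, which compensates the factor one
   half. *)
have T2 : `|s ^+ 2 / 2 *
  \sum_(j < n | (j < k)%N) (attn_coef X k j * edot (X k) (X j)
                            + attn_coef Y k j * edot (Y k) (Y j))| <= s ^+ 2.
  rewrite normrM ger0_norm ?divr_ge0 ?sqr_ge0// -mulrA ler_piMr ?sqr_ge0//.
  rewrite ler_pdivrMl// mulr1; apply: le_trans (ler_norm_sum _ _ _) _.
  apply: (@le_trans _ _ (\sum_(j < n | (j < k)%N) (attn_coef X k j + attn_coef Y k j))).
    apply: ler_sum => j _; apply: le_trans (ler_normD _ _) _.
    rewrite !(normrM _ (edot _ _)) !(ger0_norm (attn_coef_ge0 _ _ _)).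
    apply: lerD; apply: ler_piMr; rewrite ?attn_coef_ge0//;
      apply: le_trans (edot_le _ _) _; first by rewrite (SX k) (SX j) mulr1.
    by rewrite (SY k) (SY j) mulr1.
  rewrite big_split /=.
  have := attn_coef_sum_lt X k; have := attn_coef_sum_lt Y k; lra.
apply: le_trans (lerD T1 T2) _.
have -> : ((n%:R * L + n%:R) * n%:R + 1) * G = n%:R * ((L + 1) * (n%:R * G)) + G :> R.
  by ring.
apply: lerD => //; apply: ler_wpM2l => //; apply: ler_wpM2l => //.
by rewrite addr_ge0.
Qed.

(** The cap refers to all current earlier tokens instead of their limit [u], so it depends on the
    configuration alone. *)
Definition antipodal_cap (theta : R) X k :=
  forall j, (j < k)%N -> enorm (X k + X j) <= theta.

(* Linearizing around [X k = - X j], the direction of [X j] is orthogonal to the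
   sphere at [X k], so the variation of the coefficients does not contribute at
   first order and only the expansion by the projection remains. *)
Lemma field_expands_near_antipode :
  exists theta lam C : R, [/\ 0 < theta, 0 < lam, 0 <= C &
  forall X Y k eps, on_sphere X -> on_sphere Y -> (0 < k)%N -> 0 <= eps <= 1 ->
    antipodal_cap theta X k -> antipodal_cap theta Y k ->
    (forall j, (j < k)%N -> enorm (X j - Y j) <= eps) ->
    lam * edot (X k - Y k) (X k - Y k) - C * eps <=
      edot (X k - Y k) (field X k - field Y k)].
Proof.
have [c c0 [L L0 cL]] := attn_coef_bounds.
set N : R := n%:R; have N0 : 0 <= N by [].
(* The bound 1 makes the inner products at most [- 1 / 2] in the cap; the other makes the error
   [N * L * theta * s ^+ 2] at most half of the expansion [c / 2 * s ^+ 2]. *)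
pose theta := Num.min 1 (c / (4 * (N * L + 1))).
have NL1 : 0 < N * L + 1 by rewrite ltr_pwDr// mulr_ge0.
have th0 : 0 < theta by rewrite lt_min ltr01 divr_gt0// mulr_gt0.
have th1 : theta <= 1 by rewrite ge_min lexx.
have thc : N * L * theta <= c / 4.
  have : theta <= c / (4 * (N * L + 1)) by rewrite /theta ge_min lexx orbT.
  rewrite ler_pdivlMr ?mulr_gt0// => H.
  have : 0 <= N * L by rewrite mulr_ge0.
  nra.
exists theta, (c / 4), (N * (L * (4 + 4 * N)) + N * 2).
split=> //; [by rewrite divr_gt0|by rewrite addr_ge0 ?mulr_ge0 ?addr_ge0 ?mulr_ge0|].
move=> X Y k eps SX SY k0 /andP[e0 e1] cX cY XY.
rewrite edot_field_diff// -sqr_enorm; set s := enorm (X k - Y k).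
have s0 : 0 <= s by exact: enorm_ge0.
have s2 : s <= 2 by exact: usphere_dist_le2.
have rle : \sum_(i < n | (i <= k)%N) enorm (X i - Y i) <= s + N * eps.
  rewrite (bigD1 k)//= lerD2l; apply: ler_sum_const => // i /andP[ik ki].
  by apply: XY; rewrite ltn_neqAle ki.
have T1 : - (N * (L * (s + N * eps) * (s * (theta + eps)) + s * eps)) <=
  \sum_(j < n | (j < k)%N)
    ((attn_coef X k j - attn_coef Y k j) * edot (X k - Y k) (X j)
     + attn_coef Y k j * edot (X k - Y k) (X j - Y j)).
  rewrite lerNl -sumrN; apply: ler_sum_const => [|j jk].
    by rewrite addr_ge0 ?mulr_ge0// addr_ge0 ?mulr_ge0// ltW.
  apply: le_trans (ler_norm _) _; rewrite normrN.
  apply: le_trans (ler_normD _ _) _; rewrite !(normrM _ (edot _ _)).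
  have [_ aL] := cL X Y k j SX SY (ltnW jk).
  apply: lerD.
    apply: ler_pM => //.
      by apply: le_trans aL _; apply: ler_wpM2l.
    (* [X k + Y k] is orthogonal to [X k - Y k], so adding half of it to [X j] changes nothing and
       leaves a vector of norm at most [theta + eps]. *)
    have -> : edot (X k - Y k) (X j) =
        edot (X k - Y k) (2^-1 *: ((X k + X j) + ((Y k + Y j) + (X j - Y j)))).
      rewrite edotZr; apply: (@mulfI _ 2) => //.
      rewrite mulrA divff// mul1r !edotBl !edotDr !edotNr (edotC (Y k) (X k)).
      by rewrite -(sqr_enorm (X k)) -(sqr_enorm (Y k)) (SX k) (SY k); ring.
    apply: le_trans (edot_le _ _) _; apply: ler_wpM2l => //.
    rewrite enormZ ger0_norm ?invr_ge0// ler_pdivrMl//.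
    have := cX j jk; have := cY j jk; have := XY j jk.
    have := enormD (X k + X j) (Y k + Y j + (X j - Y j)).
    have := enormD (Y k + Y j) (X j - Y j).
    by lra.
  rewrite ger0_norm ?attn_coef_ge0//.
  apply: (@le_trans _ _ `|edot (X k - Y k) (X j - Y j)|).
    by apply: ler_piMl => //; apply: attn_coef_le1; exact: ltnW.
  by apply: le_trans (edot_le _ _) _; apply: ler_wpM2l => //; exact: XY.
have cap Z : on_sphere Z -> antipodal_cap theta Z k ->
    forall j, (j < k)%N -> attn_coef Z k j / 2 <= - (attn_coef Z k j * edot (Z k) (Z j)).
  move=> SZ cZ j jk; have := attn_coef_ge0 Z k j; have := cZ j jk.
  rewrite edot_antidist//; have := enorm_ge0 (Z k + Z j).
  move: (enorm _) (attn_coef _ _ _) => p a p0 pth a0.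
  have pp : p ^+ 2 <= 1 by rewrite expr_le1// (le_trans pth).
  nra.
have T2 : c <= - \sum_(j < n | (j < k)%N) (attn_coef X k j * edot (X k) (X j)
                            + attn_coef Y k j * edot (Y k) (Y j)).
  (* Token 0 alone supplies [c], half from each configuration; the other terms are nonnegative. *)
  pose o := Ordinal (leq_ltn_trans (leq0n k) (ltn_ord k)).
  rewrite -sumrN (bigD1 o)//=.
  have [aX _] := cL X Y k o SX SY (leq0n k).
  have [aY _] := cL Y X k o SY SX (leq0n k).
  have := cap X SX cX o k0; have := cap Y SY cY o k0.
  suff : 0 <= \sum_(j < n | (j < k)%N && (j != o))
    - (attn_coef X k j * edot (X k) (X j) + attn_coef Y k j * edot (Y k) (Y j)) by lra.
  apply: sumr_ge0 => j /andP[jk _].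
  have := cap X SX cX j jk; have := cap Y SY cY j jk.
  have := attn_coef_ge0 X k j; have := attn_coef_ge0 Y k j; lra.
set A := \sum_(j < n | _) _ in T1 *; set B := \sum_(j < n | _) _ in T2 *.
have s20 : 0 <= s ^+ 2 by exact: sqr_ge0.
have T3 : c * (s ^+ 2 / 2) <= - (s ^+ 2 / 2 * B) by nra.
(* Since [s <= 2] and [theta, eps <= 1], every product containing [eps] is at most a multiple of
   [eps]; only the [theta * s ^+ 2] term stays quadratic. *)
have T4 : N * (L * (s + N * eps) * (s * (theta + eps)) + s * eps) <=
    N * L * theta * s ^+ 2 + (N * (L * (4 + 4 * N)) + N * 2) * eps.
  have E : (s + N * eps) * (s * (theta + eps)) <= theta * s ^+ 2 + (4 + 4 * N) * eps.
    have H1 : s ^+ 2 * eps <= 4 * eps by apply: ler_wpM2r => //; nra.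
    have H2 : s * (theta + eps) <= 4 by nra.
    have H3 : N * eps * (s * (theta + eps)) <= N * eps * 4.
      by apply: ler_wpM2l => //; rewrite mulr_ge0.
    lra.
  have -> : N * L * theta * s ^+ 2 + (N * (L * (4 + 4 * N)) + N * 2) * eps =
    N * (L * (theta * s ^+ 2 + (4 + 4 * N) * eps) + 2 * eps) by ring.
  apply: ler_wpM2l => //; apply: lerD; last exact: ler_wpM2r.
  by rewrite -mulrA; apply: ler_wpM2l.
have T5 : N * L * theta * s ^+ 2 <= c / 4 * s ^+ 2 by exact: ler_wpM2r.
lra.
Qed.

(** If the earlier tokens were exactly at [u], the height [f = edot u (X k)] would grow at rate
    [A * (1 - f ^+ 2)], with [A] the total attention paid to them. Then [c <= A] controls the main
    term and [A <= 1] the perturbation. *)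
Lemma field_attracts : exists2 c : R, 0 < c &
  forall X k u eps, on_sphere X -> usphere u -> (0 < k)%N -> 0 <= eps <= 1 ->
    (forall j, (j < k)%N -> enorm (X j - u) <= eps) ->
    c * (1 - edot u (X k) ^+ 2) - 2 * eps <= edot u (field X k).
Proof.
have [c c0 [L L0 cL]] := attn_coef_bounds.
exists c => // X k u eps SX u1 k0 /andP[e0 e1] Xu.
rewrite edot_field//; set f := edot u (X k).
have f1 : `|f| <= 1.
  by apply: le_trans (edot_le _ _) _; rewrite u1 (SX k) mulr1.
have ff : f ^+ 2 <= 1 by rewrite -real_normK ?num_real// expr_le1.
apply: (@le_trans _ _ (\sum_(j < n | (j < k)%N)
    (attn_coef X k j * (1 - f ^+ 2) - attn_coef X k j * (2 * eps)))); last first.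
  apply: ler_sum => j jk; rewrite -mulrBr; apply: ler_wpM2l; first exact: attn_coef_ge0.
  have -> : edot (X k) (X j) = f + edot (X k) (X j - u) by rewrite edotBr (edotC _ u) -/f; ring.
  have := edot_le (X k) (X j - u); rewrite (SX k) mul1r => H.
  have {H} : `|edot (X k) (X j - u) * f| <= eps.
    rewrite normrM; apply: (@le_trans _ _ (enorm (X j - u) * 1)).
      exact: ler_pM.
    by rewrite mulr1; exact: Xu.
  rewrite (edot_dist _ _ u1 (SX j)) (enorm_distC u) ler_norml.
  have := Xu j jk; have := enorm_ge0 (X j - u).
  move: (enorm _) (edot (X k) _) => p q p0 pe /andP[_ H].
  have : p ^+ 2 <= eps by nra.
  nra.
rewrite sumrB; set A := \sum_(j < n | (j < k)%N) attn_coef X k j.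
have AE p : \sum_(j < n | (j < k)%N) attn_coef X k j * p = A * p by rewrite mulr_suml.
rewrite !AE.
have A1 : A <= 1 := attn_coef_sum_lt X k.
have Ac : c <= A.
  pose o := Ordinal (leq_ltn_trans (leq0n k) (ltn_ord k)).
  rewrite /A (bigD1 o)//=; have [aX _] := cL X X k o SX SX (leq0n k).
  apply: le_trans aX _; rewrite lerDl.
  by apply: sumr_ge0 => *; exact: attn_coef_ge0.
have : 0 <= 1 - f ^+ 2 by rewrite subr_ge0.
move: (1 - _) => p p0; nra.
Qed.

End attention_field.

(** * Null graphs *)

Definition graph_over {T : Type} {n : nat} (k : 'I_n) (A : set (n.-tuple T)) :=
  forall X Y, A X -> A Y ->
    (forall j, j != k -> tnth X j = tnth Y j) -> tnth X k = tnth Y k.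

(** Fubini, peeling off the head coordinate. If [k] is in the tail, the slices at a fixed head are
    graphs again; if [k] is the head, the slices at a fixed tail have at most one point. *)
Lemma tuple_measure_graph d (T : measurableType d) (R : realType)
    (mu : {sigma_finite_measure set T -> \bar R}) :
    (forall z, mu [set z] = 0%E) ->
  forall n (k : 'I_n) (A : set (n.-tuple T)),
    measurable A -> graph_over k A -> tuple_measure mu n A = 0%E.
Proof.
move=> mu1; elim=> [|n IH] k A mA gA; first by case: k gA => -[].
have mA' : measurable (@tuple_cons _ T n @^-1` A).
  rewrite -[X in measurable X]setTI; exact: measurable_tuple_cons.
rewrite /= /cons_measure /pushforward.
have [k' kE|k0] := unliftP ord0 k.
- rewrite /product_measure1; apply: integral0_eq => z _ /=.
  apply: (IH k'); first exact: measurable_xsection.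
  move=> X Y; rewrite /xsection /= !inE => AX AY XY.
  have := gA _ _ AX AY; rewrite kE !tnthS; apply=> j.
  have [j' ->|->//] := unliftP ord0 j.
  by rewrite (inj_eq lift_inj) !tnthS; exact: XY.
(* The measure of the product is recomputed with the order of integration exchanged. *)
- rewrite (@product_measure_unique _ _ _ _ _ _ _ (mu \x^ tuple_measure mu n)%E)
    //=; last by move=> *; rewrite product_measure2E.
  rewrite /product_measure2; apply: integral0_eq => X _ /=.
  set B := ysection _ _.
  have [->|/set0P[z Bz]] := eqVneq B set0; first by rewrite measure0.
  suff -> : B = [set z] by exact: mu1.
  apply/seteqP; split=> [y By|_ -> //].
  move: Bz By; rewrite /B /ysection /= !inE => Bz By.
  have := gA _ _ By Bz; rewrite k0; apply=> j.
  by have [j' ->|->] := unliftP ord0 j; rewrite ?eqxx// !tnthS.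
Qed.

Lemma measurable_tuple_set1 d (T : measurableType d) n (t : n.-tuple T) :
  (forall z : T, measurable [set z]) -> measurable [set t].
Proof.
move=> m1.
rewrite (_ : [set t] = [set X | forall i, [set tnth t i] (tnth X i)]).
  exact: (@measurable_tuple_box _ T n (fun i => [set tnth t i])).
apply/seteqP; split=> [_ ->//|X tX /=].
by apply: eq_from_tnth => i; exact: tX.
Qed.

(** * Points are null for the surface measure *)

Section sphere_null.
Context {R : realType} {d : nat} (d_ge2 : (2 <= d)%N).
Local Notation T := (d.-tuple (measurableTypeR R)).

(* The cone over a point is contained in a line, which is a graph over any
   coordinate other than one along which the line is not constant. *)
Lemma sphere_measure_set1 (v : T) : sphere_measure [set v] = 0%E.
Proof.
have m1 (t : T) : measurable [set t].
  by apply: (@measurable_tuple_set1 _ (measurableTypeR R)); exact: measurable_set1.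
set S := (@tuple_normalize R d @^-1` [set v]) `&` @unit_ball_tuple R d.
suff S0 : lebesgue_tuple S = 0%E.
  rewrite /sphere_measure /pushforward /= /mscale /= /mfrestr /mrestr.
  by rewrite -/S S0 mule0.
have [->|/set0P[t0 [/= t0v Bt0]]] := eqVneq S set0; first by rewrite measure0.
have mS : measurable S.
  apply: measurableI; last exact: measurable_unit_ball_tuple.
  rewrite -[X in measurable X]setTI.
  exact: measurable_tuple_normalize.
have [j vj] : exists j, tnth v j != 0.
  apply/not_existsP => v0.
  have := enorm_tuple_normalize Bt0; rewrite t0v /usphere /= /enorm /edot.
  rewrite big1 ?sqrtr0; first by move/esym/eqP; rewrite oner_eq0.
  by move=> i _; have /negP := v0 i; rewrite negbK mxE => /eqP ->; rewrite mul0r.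
have [k kj] : exists k : 'I_d, k != j.
  have : (0 < #|predC1 j|)%N by rewrite cardC1 card_ord; case: (d) d_ge2 => [|[]].
  by case/card_gt0P => k; rewrite !inE => ?; exists k.
apply: (tuple_measure_graph _ (measurableTypeR R) R (@lebesgue_measure R) _ d k).
- by move=> z; exact: lebesgue_measure_set1.
- exact: mS.
move=> X Y [/= Xv /andP[X0 _]] [/= Yv /andP[Y0 _]] XY.
(* A point of the cone is its norm times [v]; agreement at [j], where [v] does not vanish, forces
   equal norms. *)
have E (Z : T) : 0 < enorm (tuple_col Z) -> tuple_normalize Z = v ->
    forall i, tnth Z i = enorm (tuple_col Z) * tnth v i.
  by move=> Z0 <- i; rewrite tnth_mktuple mulrCA divff ?mulr1// gt_eqF.
have := XY j; rewrite eq_sym => /(_ kj).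
by rewrite (E X)// (E Y)// => /(mulIf vj); rewrite (E X X0 Xv k) (E Y Y0 Yv k) => ->.
Qed.

End sphere_null.

(** * Grid approximation of uniformly continuous graphs *)

Section grid.
Context {R : realType} {d n : nat}.
Local Notation T := (d.-tuple (measurableTypeR R)).
Implicit Types (X Y : n.-tuple T) (B : set (n.-tuple T)).

(** Integer label of the half-open cube of side [1 / (m + 1)] containing [X]. Labels form a
    countable type, so any union of cells is measurable. *)
Definition grid_cell (m : nat) X : 'M[int]_(n, d) :=
  \matrix_(i, j) Num.floor (m.+1%:R * tnth (tnth X i) j).

Lemma grid_cell_dist m X Y i j : grid_cell m X = grid_cell m Y ->
  `|tnth (tnth X i) j - tnth (tnth Y i) j| < m.+1%:R^-1.
Proof.
move=> /matrixP/(_ i j); rewrite !mxE => XY.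
have /andP[X1 X2] := Num.Theory.floor_itv (m.+1%:R * tnth (tnth X i) j).
have /andP[Y1 Y2] := Num.Theory.floor_itv (m.+1%:R * tnth (tnth Y i) j).
rewrite XY in X1 X2; rewrite intrD in X2; rewrite intrD in Y2.
have m0 : 0 < m.+1%:R :> R by [].
rewrite -(ltr_pM2l m0) -{1}(gtr0_norm m0) -normrM mulfV ?gt_eqF// mulrBr ltr_norml.
by apply/andP; split; lra.
Qed.

Lemma measurable_grid_cell m c : measurable [set X | grid_cell m X = c].
Proof.
pose F i j : set (measurableTypeR R) := [set r : R | Num.floor (m.+1%:R * r) = c i j].
have mF i j : measurable (F i j).
  have -> : F i j = `[(c i j)%:~R / m.+1%:R, (c i j + 1)%:~R / m.+1%:R[%classic.
    apply/seteqP; split=> r /=; rewrite in_itv /= ler_pdivrMr// ltr_pdivlMr// mulrC.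
      by move=> <-; exact: Num.Theory.floor_itv.
    by move=> cr; apply: Num.Theory.floor_def.
  exact: measurable_itv.
pose G i := [set t : T | forall j, F i j (tnth t j)].
have mG i : measurable (G i).
  exact: (@measurable_tuple_box _ (measurableTypeR R) d (F i)).
rewrite (_ : [set X | _] = [set X | forall i, G i (tnth X i)]).
  exact: (@measurable_tuple_box _ T n G).
apply/seteqP; split=> X /=.
  by move=> Xc i j; rewrite /F /= -Xc mxE.
by move=> GX; apply/matrixP => i j; rewrite mxE; exact: GX.
Qed.

(** Being a graph would not survive the replacement of [B] by nearby cells; this uniform modulus
    does. *)
Definition unif_graph_over (k : 'I_n) B := forall eps : R, 0 < eps ->
  exists2 del : R, 0 < del & forall X Y, B X -> B Y ->
    (forall i j, i != k -> `|tnth (tnth X i) j - tnth (tnth Y i) j| < del) ->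
    forall j, `|tnth (tnth X k) j - tnth (tnth Y k) j| < eps.

(* [B] need not be measurable; it is contained in the intersection over [m] of
   the union of the cells of side [1 / (m + 1)] that meet [B], which is
   measurable and is still a graph. *)
Lemma unif_graph_negligible (mu : {sigma_finite_measure set T -> \bar R})
    (k : 'I_n) B : (forall z, mu [set z] = 0%E) ->
  unif_graph_over k B -> (tuple_measure mu n).-negligible B.
Proof.
move=> mu1 uB.
pose G := \bigcap_m [set X | exists2 Y, B Y & grid_cell m X = grid_cell m Y].
have mG : measurable G.
  apply: bigcapT_measurable => m.
  rewrite (_ : [set X | _] = \bigcup_(c in grid_cell m @` B)
    [set X | grid_cell m X = c]); last first.
    apply/seteqP; split=> [X [Y BY XY]|X [_ [Y BY <-] XY]].
    - by exists (grid_cell m Y) => //; exists Y.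
    - by exists Y.
  rewrite bigcup_mkcond; apply: countable_bigcupT_measurable => [//|c].
  by case: ifP => // _; exact: measurable_grid_cell.
exists G; split=> [//||X BX m _]; last by exists X.
apply: (tuple_measure_graph _ T R mu mu1 n k) => //.
move=> X Y GX GY XY; apply: eq_from_tnth => j; apply/eqP.
rewrite -subr_eq0 -normr_eq0 -[X in _ == X]/(0%R) eq_le normr_ge0 andbT.
apply/ler_addgt0Pr => e e0; rewrite add0r.
have e3 : 0 < e / 3 by lra.
have [del del0 H] := uB _ e3.
(* Half of [del], since [X'] and [Y'] each deviate by [r] from points that agree off [k]; a third of
   [e] for the triangle inequality through [X'] and [Y']. *)
pose r := Num.min (del / 2) (e / 3).
have r0 : 0 < r by rewrite lt_min; apply/andP; split; lra.
have [m mr] : exists m, m.+1%:R^-1 < r.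
  exists (Num.truncn r^-1).
  by rewrite invf_plt ?posrE// Num.Theory.truncnS_gt.
have [rd re] : r <= del / 2 /\ r <= e / 3 by rewrite /r !ge_min !lexx orbT.
have [X' BX' XX'] := GX m I; have [Y' BY' YY'] := GY m I.
have dX i i' := lt_trans (grid_cell_dist m X X' i i' XX') mr.
have dY i i' := lt_trans (grid_cell_dist m Y Y' i i' YY') mr.
have : `|tnth (tnth X' k) j - tnth (tnth Y' k) j| < e / 3.
  apply: H => // i i' ik.
  have := dX i i'; have := dY i i'; rewrite (XY i ik) !ltr_norml => /andP[? ?] /andP[? ?].
  by apply/andP; split; lra.
move: (dX k j) (dY k j); rewrite !ltr_norml ler_norml.
move=> /andP[? ?] /andP[? ?] /andP[? ?]; apply/andP; split; lra.
Qed.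

End grid.

(** * Differential inequalities and repulsion from the antipode *)

Section scalar_inequalities.
Context {R : realType}.
Implicit Types (f df : R -> R) (a b : R).

(** Gronwall: [expR (- lam * t) * f t] is nondecreasing. The sign of [lam] is free, and upper bounds
    follow by applying it to [- f]. *)
Lemma exp_growth f df lam a b : a <= b -> {within `[a, b], continuous f} ->
  (forall t, a < t < b -> is_derive t 1 f (df t)) ->
  (forall t, a < t < b -> lam * f t <= df t) ->
  expR (lam * (b - a)) * f a <= f b.
Proof.
rewrite le_eqVlt => /predU1P[->|ab] cf Df lf.
  by rewrite subrr mulr0 expR0 mul1r.
pose h t := expR (- lam * t) * f t.
pose dh t := expR (- lam * t) * (df t - lam * f t).
have Dh t : t \in `]a, b[ -> is_derive t 1 h (dh t).
  rewrite in_itv /= => /Df Dft.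
  have De : is_derive t 1 (fun s => expR (- lam * s)) (- lam * expR (- lam * t)).
    have H : is_derive t 1 (fun s : R => - lam * s) (- lam).
      have := is_deriveZ (- lam) (is_derive_id t (1 : R)) => /is_derive_eq; apply.
      exact: mulr1.
    by apply: is_derive_eq; rewrite mulrC.
  have := is_deriveM De Dft => /is_derive_eq; apply.
  by rewrite /dh /GRing.scale /=; ring.
have ch : {within `[a, b], continuous h}.
  move=> s; apply: cvgM; last exact: cf.
  apply: continuous_subspaceT => r.
  apply: continuous_comp; last exact: continuous_expR.
  exact: mulrl_continuous.
have [c] := MVT ab Dh ch; rewrite in_itv /= => cab E.
have : 0 <= h b - h a.
  rewrite E mulr_ge0//; last by rewrite subr_ge0 ltW.
  by rewrite mulr_ge0 ?expR_ge0// subr_ge0 lf.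
rewrite subr_ge0 /h => H; have := ler_wpM2l (expR_ge0 (lam * b)) H.
by rewrite !mulrA -!expRD !mulNr subrr expR0 mul1r -mulrBr.
Qed.

Lemma within_itv_continuousP f a b s e : {within `[a, b], continuous f} ->
  a <= s <= b -> 0 < e ->
  exists2 del, 0 < del &
    forall t, a <= t <= b -> `|s - t| < del -> `|f s - f t| < e.
Proof.
move=> /subspace_continuousP cf sab e0.
have abs : `[a, b]%classic s by rewrite /= in_itv.
have /cvgrPdist_lt fs := cf s abs.
have /nbhs_ballP[del /= del0 H] := fs e e0.
by exists del => // t tab st; apply: H => //=; rewrite in_itv.
Qed.

(** After the last time [s] with [al <= f s], continuity holds [f] for a while in the band between
    [lo] and [al], where it cannot decrease; the mean value theorem then contradicts the drop below
    [al]. *)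
Lemma lower_barrier f df lo al a b : a <= b -> {within `[a, b], continuous f} ->
  (forall t, a < t < b -> is_derive t 1 f (df t)) ->
  (forall t, a < t < b -> lo < f t < al -> 0 <= df t) ->
  lo < al -> al <= f a -> al <= f b.
Proof.
move=> ab cf Df df0 loal fa; rewrite leNgt; apply/negP => fb.
pose S := [set t | a <= t <= b /\ al <= f t].
have Sa : S a by split; rewrite ?lexx.
have hS : has_sup S by split; [exists a|exists b => t [/andP[]]].
set s := sup S.
have as_ : a <= s by apply: ub_le_sup Sa; exists b => t [/andP[]].
have sb : s <= b by apply: ge_sup; [exists a|move=> t [/andP[]]].
have sab : a <= s <= b by rewrite as_.
have fs : al <= f s.
  rewrite leNgt; apply/negP => fs.
  have e0 : 0 < al - f s by rewrite subr_gt0.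
  have [del del0 H] := within_itv_continuousP _ _ _ _ _ cf sab e0.
  have [t [tab ft] st] := sup_adherent del0 hS.
  have ts : t <= s by apply: ub_le_sup => //; exists b => r [/andP[]].
  have := H t tab; rewrite ger0_norm ?subr_ge0// ltrBlDl -ltrBlDr => /(_ st).
  by rewrite ltr_norml => /andP[]; lra.
have {}sb : s < b by rewrite lt_neqAle sb andbT; apply: contraTneq fb => <-; rewrite -leNgt.
have e0 : 0 < f s - lo by rewrite subr_gt0; exact: lt_le_trans fs.
have [del del0 H] := within_itv_continuousP _ _ _ _ _ cf sab e0.
pose t := Num.min (s + del / 2) b.
have st : s < t by rewrite lt_min sb andbT; lra.
have tb : t <= b by rewrite ge_min lexx orbT.
have td : t <= s + del / 2 by rewrite ge_min lexx.
have Hlo r : s < r <= t -> lo < f r.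
  move=> /andP[sr rt]; have := H r; rewrite (le_trans as_ (ltW sr)) (le_trans rt tb).
  move=> /(_ isT); rewrite ltr0_norm ?subr_lt0// opprB.
  have rd : r - s < del by lra.
  by move=> /(_ rd); rewrite ltr_norml => /andP[_]; lra.
have Hal r : s < r <= t -> f r < al.
  move=> /andP[sr rt]; rewrite ltNge; apply/negP => fr.
  suff : r <= s by rewrite leNgt sr.
  apply: ub_le_sup; first by exists b => q [/andP[]].
  by split => //; rewrite (le_trans as_ (ltW sr)) (le_trans rt tb).
have Dst r : r \in `]s, t[ -> is_derive r 1 f (df r).
  rewrite in_itv /= => /andP[sr rt]; apply: Df.
  by rewrite (le_lt_trans as_ sr) (lt_le_trans rt tb).
have cst : {within `[s, t], continuous f}.
  by apply: continuous_subspaceW cf; apply: subset_itv; rewrite bnd_simp.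
have [r] := MVT st Dst cst; rewrite in_itv /= => /andP[sr rt] E.
have ft : f t < al by apply: Hal; rewrite st /=.
have : 0 <= df r * (t - s).
  apply: mulr_ge0; last by rewrite subr_ge0 ltW.
  apply: df0; first by rewrite (le_lt_trans as_ sr) (lt_le_trans rt tb).
  by rewrite Hlo ?Hal// sr ltW.
by rewrite -E; lra.
Qed.

End scalar_inequalities.

Section edot_calculus.
Context {R : realType} {d : nat}.

Lemma continuous_edot (T : topologicalType) (f g : T -> 'cV[R]_d) :
  continuous f -> continuous g -> continuous (fun s => edot (f s) (g s)).
Proof.
move=> cf cg; rewrite /edot.
have cc (h : T -> 'cV[R]_d) : continuous h -> forall i, continuous (fun s => h s i 0).
  move=> ch i r; apply: (@continuous_comp _ _ _ h (fun v : 'cV[R]_d => v i 0)).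
    exact: ch.
  exact: coord_continuous.
by apply: continuous_big => [|i _ s]; [exact: add_continuous|apply: cvgM; exact: cc].
Qed.

Lemma is_derive_edot (f g : R -> 'cV[R]_d) df dg (t : R) :
  is_derive t 1 f df -> is_derive t 1 g dg ->
  is_derive t 1 (fun s => edot (f s) (g s)) (edot df (g t) + edot (f t) dg).
Proof.
have cd (h : R -> 'cV[R]_d) dh : is_derive t 1 h dh ->
    forall i, is_derive t 1 (fun s => h s i 0) (dh i 0).
  move=> [hd hv] i; split; first exact: (derivable_mxP h t 1).1.
  by rewrite -hv derive_mx// mxE.
move=> /cd Df /cd Dg.
have -> : (fun s => edot (f s) (g s)) =
    \sum_(i < d) (fun s => f s i 0 * g s i 0).
  by apply/funext => s; rewrite fct_sumE.
have H : is_derive t 1 (\sum_(i < d) (fun s => f s i 0 * g s i 0))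
    (\sum_(i < d) (f t i 0 *: dg i 0 + g t i 0 *: df i 0)).
  apply: (@is_derive_sum _ _ _ _ (fun i s => f s i 0 * g s i 0)) => i.
  exact: is_deriveM.
apply: is_derive_eq; rewrite -big_split /=; apply: eq_bigr => i _.
by rewrite /GRing.scale /=; ring.
Qed.

End edot_calculus.

(** * Comparison of two solutions *)

Section two_solutions.
Context {R : realType} {d n : nat}.
Variables (beta : R) (Q K : 'M[R]_d).
Implicit Types (s t : R) (x y : 'I_n -> R -> 'cV[R]_d) (k : 'I_n).

Local Notation field := (causal_field beta Q K).
Local Notation solution := (causal_solution beta Q K).

Lemma within_nonneg_itv (T : topologicalType) (f : R -> T) a b : 0 <= a ->
  {within `[0, +oo[, continuous f} -> {within `[a, b], continuous f}.
Proof.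
by move=> a0; apply: continuous_subspaceW; apply: subset_itv; rewrite bnd_simp.
Qed.

Let D x y k t := edot (x k t - y k t) (x k t - y k t).
Let dD x y k t := 2 * edot (x k t - y k t) (field (x ^~ t) k - field (y ^~ t) k).

Lemma continuous_sqdist x y k : solution x -> solution y ->
  {within `[0, +oo[, continuous (D x y k)}.
Proof.
move=> [_ cx _] [_ cy _].
by apply: continuous_edot => s; apply: cvgB; [exact: cx|exact: cy|exact: cx|exact: cy].
Qed.

Lemma is_derive_sqdist x y k t : solution x -> solution y -> 0 < t ->
  is_derive t 1 (D x y k) (dD x y k t).
Proof.
move=> [_ _ dx] [_ _ dy] t0.
have H := is_deriveB (dx k t t0) (dy k t t0).
apply: is_derive_eq; first exact: is_derive_edot.
by rewrite /dD edotC; ring.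
Qed.

(** The forward bound keeps earlier tokens close up to a chosen time; the backward bound carries
    closeness at a later time back to the initial data. *)
Lemma prefix_dist_growth : exists2 L : R, 0 <= L & forall x y (m : nat) (t : R),
  solution x -> solution y -> 0 <= t ->
  let G s := \sum_(j < n | (j < m)%N) D x y j s in
  G t <= expR (L * t) * G 0 /\ G 0 <= expR (L * t) * G t.
Proof.
have [L L0 HL] := field_one_sided_lipschitz (n := n) beta Q K.
exists (n%:R * (2 * L)) => [|x y m t sx sy t0 G]; first by rewrite !mulr_ge0.
pose dG s := \sum_(j < n | (j < m)%N) dD x y j s.
have D0 j s : 0 <= D x y j s by exact: edot_ge0.
have cG : {within `[0, t], continuous G}.
  apply: (@within_nonneg_itv _ _ 0 t) => //.
  apply: continuous_big => [|j _]; [exact: add_continuous|exact: continuous_sqdist].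
have DG s : 0 < s < t -> is_derive s 1 G (dG s).
  move=> /andP[s0 _].
  have -> : G = \sum_(j < n) (fun r => if (j < m)%N then D x y j r else 0).
    by apply/funext => r; rewrite fct_sumE /G big_mkcond.
  rewrite /dG [X in is_derive _ _ _ X]big_mkcond /=.
  apply: (@is_derive_sum _ _ _ _
    (fun (j : 'I_n) r => if (j < m)%N then D x y j r else 0)) => j.
  case: ifP => _; first exact: is_derive_sqdist.
  exact: is_derive_cst.
have bG s : 0 < s < t -> `|dG s| <= n%:R * (2 * L) * G s.
  move=> /andP[s0 _]; apply: le_trans (ler_norm_sum _ _ _) _.
  rewrite -mulrA; apply: ler_sum_const => [|j jm].
    by rewrite !mulr_ge0// sumr_ge0.
  rewrite normrM ger0_norm// -mulrA ler_wpM2l//.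
  have [Sx _ _] := sx; have [Sy _ _] := sy.
  have Sxs i : usphere (x i s) by apply: Sx; exact: ltW.
  have Sys i : usphere (y i s) by apply: Sy; exact: ltW.
  apply: le_trans (HL (x ^~ s) (y ^~ s) j Sxs Sys) _; apply: ler_wpM2l => //.
  rewrite /G [leRHS](bigID (fun i : 'I_n => (i <= j)%N)) /=.
  rewrite [X in _ <= X + _](eq_bigl (fun i : 'I_n => (i <= j)%N)) => [|i].
    by rewrite lerDl sumr_ge0.
  by case: (leqP i j) => [/leq_ltn_trans->|]; rewrite ?andbF.
have DGN s : 0 < s < t -> is_derive s 1 (fun r => - G r) (- dG s).
  by move=> st; apply: is_deriveN; exact: DG.
have cGN : {within `[0, t], continuous (fun r => - G r)}.
  by move=> s; apply: cvgN; exact: cG.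
split.
- have := exp_growth _ _ (n%:R * (2 * L)) _ _ t0 cGN DGN; rewrite subr0 mulrN lerN2; apply.
  move=> s st; rewrite mulrN lerN2; apply: le_trans (bG s st); exact: ler_norm.
- have := exp_growth _ _ (- (n%:R * (2 * L))) _ _ t0 cG DG; rewrite subr0 mulNr => H.
  have {H} : expR (- (n%:R * (2 * L) * t)) * G 0 <= G t.
    apply: H => s st; rewrite mulNr lerNl; apply: le_trans (bG s st).
    by rewrite -normrN ler_norm.
  by rewrite expRN ler_pdivrMl ?expR_gt0.
Qed.

(** An existential over solutions instead of a flow map: two data are compared through any solutions
    issued from them. *)
Definition antipodal_data (theta T : R) k : set (n.-tuple (d.-tuple (measurableTypeR R))) :=
  [set X0 | exists x, [/\ solution x,
    forall j, x j 0 = tuple_col (tnth X0 j) &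
    forall t, T <= t -> antipodal_cap theta (x ^~ t) k]].

(* While both trajectories stay in the cap their k-th tokens separate
   exponentially, up to an error controlled by the distance of the previous
   tokens. As distances are bounded, the k-th tokens had to be close at the
   start as soon as the previous ones were. *)
Lemma antipodal_data_unif_graph : exists2 theta : R, 0 < theta &
  forall (T : R) k, 0 <= T -> (0 < k)%N ->
    unif_graph_over k (antipodal_data theta T k).
Proof.
have [theta [lam [C [th0 lam0 C0 HE]]]] :=
  field_expands_near_antipode (n := n) beta Q K.
have [L L0 HG] := prefix_dist_growth.
exists theta => // T k T0 k0 e e0.
pose M := expR (L * T); have M0 : 0 < M by exact: expR_gt0.
(* [M] is the loss in going back from [T] to 0: a squared distance at most [2 * b] at [T] becomes at
   most [e ^+ 2 / 2] at 0. *)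
pose b := e ^+ 2 / (4 * M); have b0 : 0 < b by rewrite divr_gt0 ?exprn_gt0 ?mulr_gt0.
pose A := C / lam + n%:R; have A0 : 0 <= A by rewrite addr_ge0// divr_ge0// ltW.
(* Chosen so that the expansion factor from [T] to [S] is [expR (4 / b)]. *)
pose S := T + 4 / b / (2 * lam).
have TS : T <= S by rewrite lerDl !divr_ge0 ?mulr_ge0 ?ltW.
have S0 : 0 <= S := le_trans T0 TS.
pose eps := Num.min 1 (b / (A + 1)).
have A1 : 0 < A + 1 by lra.
have eps0 : 0 < eps by rewrite lt_min ltr01 divr_gt0.
have eps1 : eps <= 1 by rewrite ge_min lexx.
have epsb : A * eps <= b.
  have : eps <= b / (A + 1) by rewrite ge_min lexx orbT.
  by rewrite ler_pdivlMr// => ?; nra.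
(* [n * d] passes from coordinates to the squared prefix distance, and the exponential absorbs its
   growth up to time [S]. *)
pose B := (n%:R * d%:R + 1) * expR (L * S).
have E1 : 1 <= expR (L * S) by rewrite -(@expR0 R) ler_expR mulr_ge0.
have nd0 : 0 <= n%:R * d%:R :> R by rewrite mulr_ge0.
have B0 : 0 < B by rewrite mulr_gt0 ?expR_gt0// ltr_pwDr.
have eB0 : 0 < eps / B by rewrite divr_gt0.
exists (eps / B) => // X Y.
move=> [x [sx x0 cx]] [y [sy y0 cy]] XY l.
have [Sx _ _] := sx; have [Sy _ _] := sy.
pose G m s := \sum_(j < n | (j < m)%N) D x y j s.
have D0 j s : 0 <= D x y j s by exact: edot_ge0.
have DE j s : D x y j s = enorm (x j s - y j s) ^+ 2 by rewrite sqr_enorm.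
have init (j : 'I_n) : (j < k)%N -> D x y j 0 <= d%:R * (eps / B) ^+ 2.
  move=> jk; rewrite /D /edot; apply: (@ler_sum_const _ _ xpredT) => [|i _].
    by rewrite sqr_ge0.
  rewrite -expr2 -real_normK ?num_real// ler_pXn2r ?nnegrE ?(ltW eB0)//.
  by apply: ltW; rewrite x0 y0 !mxE; apply: XY; rewrite neq_ltn jk.
have G0 : G k 0 <= n%:R * (d%:R * (eps / B) ^+ 2).
  apply: ler_sum_const => [|j jk]; last exact: init.
  by apply: mulr_ge0 => //; exact: sqr_ge0.
have Geps s : 0 <= s <= S -> G k s <= eps ^+ 2.
  move=> /andP[s0 sS]; have [/le_trans + _] := HG x y k s sx sy s0; apply.
  apply: (@le_trans _ _ (expR (L * S) * (n%:R * (d%:R * (eps / B) ^+ 2)))).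
    apply: ler_pM; rewrite ?expR_ge0 ?sumr_ge0//.
    by rewrite ler_expR ler_wpM2l.
  have -> : expR (L * S) * (n%:R * (d%:R * (eps / B) ^+ 2)) =
      eps ^+ 2 * (expR (L * S) * (n%:R * d%:R) / B ^+ 2).
    by move: (expR _) B0; clearbody B eps => p B0; field; rewrite gt_eqF.
  rewrite ler_piMr ?sqr_ge0// ler_pdivrMr ?exprn_gt0// mul1r /B exprMn.
  move: (expR _) (n%:R * d%:R) E1 nd0 => p q p1 q0.
  rewrite mulrC; apply: ler_pM => //; [lra|nra|nra].
have near s (j : 'I_n) : 0 <= s <= S -> (j < k)%N -> enorm (x j s - y j s) <= eps.
  move=> sS jk; rewrite -(@ler_pXn2r _ 2)// ?nnegrE ?enorm_ge0 ?(ltW eps0)// -DE.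
  apply: le_trans (Geps s sS); rewrite /G (bigD1 j)//= lerDl.
  by apply: sumr_ge0.
have kT : D x y k T <= C / lam * eps + b.
  (* Subtracting the equilibrium value turns the affine inequality into [2 * lam * g <= g']. *)
  pose g s := D x y k s - C / lam * eps.
  have cg : {within `[T, S], continuous g}.
    move=> s; apply: cvgB; last exact: cvg_cst.
    by apply: (within_nonneg_itv _ _ _ _ T0); exact: continuous_sqdist.
  have Dg s : T < s < S -> is_derive s 1 g (dD x y k s).
    move=> /andP[Ts _]; rewrite -[dD _ _ _ _]subr0; apply: is_deriveB.
    by apply: is_derive_sqdist => //; exact: le_lt_trans Ts.
  have gg s : T < s < S -> 2 * lam * g s <= dD x y k s.
    move=> /andP[Ts sS]; have s0 : 0 <= s by rewrite (le_trans T0)// ltW.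
    have e01 : 0 <= eps <= 1 by rewrite ltW.
    have sS' : 0 <= s <= S by rewrite s0 ltW.
    have := HE (x ^~ s) (y ^~ s) k eps (fun i => Sx i s s0) (fun i => Sy i s s0) k0 e01
      (cx s (ltW Ts)) (cy s (ltW Ts)) (fun j => near s j sS').
    rewrite /g /dD -/(D x y k s) => H.
    have -> : 2 * lam * (D x y k s - C / lam * eps) = 2 * (lam * D x y k s - C * eps).
      by field; rewrite gt_eqF.
    by rewrite ler_pM2l.
  have := exp_growth _ _ (2 * lam) _ _ TS cg Dg gg.
  have -> : 2 * lam * (S - T) = 4 / b.
    by rewrite /S; field; rewrite !gt_eqF.
  have D4 : D x y k S <= 4.
    rewrite DE (_ : 4 = 2 ^+ 2 :> R); last by ring.
    rewrite ler_pXn2r ?nnegrE ?enorm_ge0//.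
    by apply: usphere_dist_le2; [exact: Sx|exact: Sy].
  have Ce : 0 <= C / lam * eps by rewrite mulr_ge0 ?(ltW eps0)// divr_ge0// ltW.
  have := expR_ge1Dx (4 / b); rewrite /g => eb H.
  (* A gap above [b] at [T] would grow beyond [(1 + 4 / b) * b > 4] by time [S], while squared
     distances on the sphere are at most 4. *)
  rewrite -lerBlDl; have [//|gb] := leP (D x y k T - C / lam * eps) b.
  have : 4 < expR (4 / b) * (D x y k T - C / lam * eps).
    apply: (@lt_le_trans _ _ ((1 + 4 / b) * b)); last first.
      apply: ler_pM; [|exact: ltW|exact: eb|exact: ltW].
      by apply: addr_ge0 => //; apply: divr_ge0 => //; exact: ltW.
    by rewrite mulrDl divfK ?gt_eqF//; lra.
  by lra.
have k0e : D x y k 0 < e ^+ 2.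
  (* The prefix of length [k.+1] includes token [k] itself. *)
  have [_ H] := HG x y k.+1 T sx sy T0.
  have split s : \sum_(j < n | (j < k.+1)%N) D x y j s = D x y k s + G k s.
    rewrite (bigD1 k)//=; congr (_ + _); apply: eq_bigl => j.
    by rewrite ltnS ltn_neqAle andbC.
  move: H; rewrite /= !split => H.
  have GT : G k T <= n%:R * eps.
    apply: ler_sum_const => [|j jk]; first by rewrite ltW.
    have := near T j _ jk; rewrite T0 TS => /(_ isT); rewrite DE.
    by have := enorm_ge0 (x j T - y j T); nra.
  have Gk0 : 0 <= G k 0 by exact: sumr_ge0.
  apply: (@le_lt_trans _ _ (M * (2 * b))).
    apply: (@le_trans _ _ (M * (D x y k T + G k T))); first by rewrite -/M in H; lra.
    by rewrite ler_pM2l//; rewrite /A in epsb; lra.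
  have -> : M * (2 * b) = e ^+ 2 / 2 by rewrite /b; field; rewrite gt_eqF.
  by have := exprn_gt0 2 e0; lra.
have := coord_le_enorm (x k 0 - y k 0) l; rewrite x0 y0 !mxE; move/le_lt_trans; apply.
rewrite -x0 -y0 -(@ltr_pXn2r _ 2) ?nnegrE ?enorm_ge0 ?ltW//.
by rewrite -DE.
Qed.

End two_solutions.

(** * Convergence *)

Section convergence.
Context {R : realType} {d n : nat} (n_gt0 : (0 < n)%N).
Variables (beta : R) (Q K : 'M[R]_d).
Implicit Types (s t : R) (k : 'I_n).

Local Notation field := (causal_field beta Q K).
Local Notation solution := (causal_solution beta Q K).
Local Notation o := (Ordinal n_gt0).

Lemma near_pinftyP (P : R -> Prop) :
  (\forall t \near +oo, P t) <-> exists2 T, 0 <= T & forall t, T <= t -> P t.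
Proof.
split=> [[M [_ HM]]|[T T0 HT]]; last first.
  by exists T; split=> [|t /ltW]; [exact: num_real|exact: HT].
exists (Num.max 0 (M + 1)); first by rewrite le_max lexx.
move=> t; rewrite ge_max => /andP[_ Mt]; apply: HM; lra.
Qed.

(** The field vanishes at token 0, so the squared distance to the initial position has zero
    derivative. *)
Lemma first_token_fixed x t : solution x -> 0 <= t -> x o t = x o 0.
Proof.
move=> [Sx cx dx] t0.
pose D s := edot (x o s - x o 0) (x o s - x o 0).
have cD : {within `[0, t], continuous (fun s => - D s)}.
  apply: (within_nonneg_itv _ _ 0 t) => //.
  have H : {within `[0, +oo[, continuous D}.
    by apply: continuous_edot => r; (apply: cvgB; [exact: cx|exact: cvg_cst]).
  by move=> s; apply: cvgN; exact: H.
have dD s : 0 < s < t -> is_derive s 1 (fun s => - D s) 0.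
  move=> /andP[s0 _]; have Dx := dx o s s0.
  rewrite (field0 (n := n)) in Dx => //; last by move=> i; apply: Sx; exact: ltW.
  have H := is_deriveB Dx (is_derive_cst (x o 0) s 1).
  rewrite subr0 in H.
  have := is_deriveN (is_derive_edot _ _ _ _ _ H H) => /is_derive_eq; apply.
  by rewrite -[0](scale0r (0 : 'cV[R]_d)) edotZr edotZl !mul0r addr0 oppr0.
have := exp_growth _ _ 0 _ _ t0 cD dD; rewrite mul0r expR0 mul1r => H.
have : - D 0 <= - D t by apply: H => s _; rewrite mul0r.
rewrite lerN2 {2}/D subrr -[X in edot X _](scale0r 0) edotZl mul0r => D0.
apply/eqP; rewrite -subr_eq0; apply/eqP/edot_eq0/eqP.
by rewrite eq_le D0 edot_ge0.
Qed.

(** Follow the height [f t = edot u (x k t)]. Leaving the cap once the earlier tokens have settled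
    puts [f] above [-1 + rho], and a barrier keeps it there. Then [1 - f ^+ 2 >= rho * (1 - f)]
    drives [f] exponentially close to 1. *)
Lemma token_converges (theta : R) x k : 0 < theta -> solution x -> (0 < k)%N ->
  (forall m : nat, ~ forall t, m%:R <= t -> antipodal_cap theta (x ^~ t) k) ->
  (forall j : 'I_n, (j < k)%N -> forall e, 0 < e ->
    \forall t \near +oo, enorm (x j t - x o 0) <= e) ->
  forall e, 0 < e -> \forall t \near +oo, enorm (x k t - x o 0) <= e.
Proof.
move=> th0 sx k0 ncap IH e e0; have [Sx cx dx] := sx.
set u := x o 0 in IH *; have u1 : usphere u by exact: Sx.
have IHk eps : 0 < eps -> exists2 T, 0 <= T & forall t, T <= t ->
    forall j : 'I_n, (j < k)%N -> enorm (x j t - u) <= eps.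
  move=> eps0; apply/near_pinftyP; apply: filter_forall => j.
  have [jk|jk] := ltnP j k; last by near=> t.
  by apply: filterS (IH j jk eps eps0).
have [c c0 Hc] := field_attracts (n := n) beta Q K.
pose f t := edot u (x k t).
pose df t := edot u (field (x ^~ t) k).
have cf a b : 0 <= a -> {within `[a, b], continuous f}.
  move=> a0; apply: (within_nonneg_itv _ _ a b a0).
  by apply: continuous_edot => [r|]; [exact: cvg_cst|exact: cx].
have Df t : 0 < t -> is_derive t 1 f (df t).
  move=> t0; have H := is_derive_edot _ _ _ _ _ (is_derive_cst u t 1) (dx k t t0).
  apply: is_derive_eq.
  by rewrite -[0](scale0r (0 : 'cV[R]_d)) edotZl mul0r add0r.
have f1 t : 0 <= t -> -1 <= f t <= 1.
  move=> t0; rewrite -ler_norml; apply: le_trans (edot_le _ _) _.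
  by rewrite u1 (Sx k t t0) mulr1.
have fd eps T : 0 < eps <= 1 ->
    (forall t, T <= t -> forall j : 'I_n, (j < k)%N -> enorm (x j t - u) <= eps) ->
    forall t, 0 <= t -> T <= t -> c * (1 - f t ^+ 2) - 2 * eps <= df t.
  move=> /andP[eps0 eps1] HT t t0 Tt.
  apply: (Hc (x ^~ t) k u eps) => //; [by move=> i; exact: Sx|by rewrite ltW|exact: HT].
(* Outside the cap, with the earlier tokens within [theta / 2] of [u], [x k] is at least [theta / 2]
   from [- u], hence at height at least [-1 + theta ^+ 2 / 8]. *)
pose rho := Num.min 1 (theta ^+ 2 / 8).
have rho0 : 0 < rho by rewrite lt_min ltr01 divr_gt0// exprn_gt0.
have rho1 : rho <= 1 by rewrite ge_min lexx.
have rhoth : rho <= theta ^+ 2 / 8 by rewrite ge_min lexx orbT.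
have [t0 t00 ft0] : exists2 t0, 0 <= t0 & forall t, t0 <= t -> -1 + rho <= f t.
  (* With [eps <= c * rho / 4], the drift is nonnegative on the band from [-1 + rho / 2] to
     [-1 + rho], where [1 - f ^+ 2 >= rho / 2]. *)
  pose eps := Num.min (Num.min 1 (c * rho / 4)) (theta / 2).
  have eps0 : 0 < eps by rewrite !lt_min ltr01 !divr_gt0// mulr_gt0.
  have [eps1 epsc epsth] : [/\ eps <= 1, eps <= c * rho / 4 & eps <= theta / 2].
    by rewrite /eps !ge_min !lexx !orbT.
  have [T T0 HT] := IHk eps eps0.
  have [m Tm] : exists m : nat, T <= m%:R.
    by exists (Num.truncn T).+1; apply/ltW/Num.Theory.truncnS_gt.
  have [t0 [mt0 [j [jk xkj]]]] : exists t0, m%:R <= t0 /\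
      exists j : 'I_n, (j < k)%N /\ theta < enorm (x k t0 + x j t0).
    apply: contrapT => H; apply: (ncap m) => t mt j jk.
    by rewrite leNgt; apply/negP => tj; apply: H; exists t; split=> //; exists j.
  have Tt0 : T <= t0 := le_trans Tm mt0.
  have t00 : 0 <= t0 := le_trans T0 Tt0.
  exists t0 => // t t0t.
  apply: (lower_barrier f df (-1 + rho / 2) _ t0 t t0t); rewrite ?ltrD2l; [exact: cf| | |lra|].
  - by move=> s /andP[t0s _]; apply: Df; exact: le_lt_trans t0s.
  - move=> s /andP[t0s _] /andP[los sal].
    have t0s' := ltW t0s.
    have := fd eps T _ HT s (le_trans t00 t0s') (le_trans Tt0 t0s').
    rewrite eps0 eps1 => /(_ isT); apply: le_trans.
    have H : rho / 2 <= 1 - f s ^+ 2 by nra.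
    have : c * (rho / 2) <= c * (1 - f s ^+ 2) by rewrite ler_pM2l.
    by lra.
  - have := HT t0 Tt0 j jk; have := enormD (x k t0 + u) (x j t0 - u).
    rewrite addrACA subrr addr0 => H1 H2.
    have H3 : theta / 2 <= enorm (x k t0 + u) by lra.
    rewrite /f edotC edot_antidist//; last exact: Sx.
    have := enorm_ge0 (x k t0 + u); nra.
(* The equilibrium defect [2 * eps / (c * rho)] takes half of the budget [e ^+ 2 / 2] for [1 - f];
   the exponential transient takes the other half. *)
pose eps := Num.min 1 (c * rho * e ^+ 2 / 8).
have e20 : 0 < e ^+ 2 by rewrite exprn_gt0.
have cr0 : 0 < c * rho by rewrite mulr_gt0.
have eps0 : 0 < eps by rewrite lt_min ltr01 divr_gt0// mulr_gt0.
have eps1 : eps <= 1 by rewrite ge_min lexx.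
have epse : eps <= c * rho * e ^+ 2 / 8 by rewrite ge_min lexx orbT.
have [T T0 HT] := IHk eps eps0.
pose t1 := Num.max t0 T.
have [t01 Tt1] : t0 <= t1 /\ T <= t1 by rewrite /t1 !le_max !lexx orbT.
have t10 : 0 <= t1 := le_trans T0 Tt1.
have w0 : 0 <= 8 / e ^+ 2 / (c * rho) by rewrite !divr_ge0 ?ltW.
(* This delay makes the exponential at least [8 / e ^+ 2], enough to shrink a deviation of [-2] to
   [- e ^+ 2 / 4]. *)
apply/near_pinftyP; exists (t1 + 8 / e ^+ 2 / (c * rho)); first by rewrite addr_ge0.
move=> t tt; have t1t : t1 <= t by lra.
have xk1 : usphere (x k t) by apply: Sx; exact: le_trans t1t.
pose g s := f s - (1 - 2 * eps / (c * rho)).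
have cg : {within `[t1, t], continuous g}.
  by move=> s; apply: cvgB; [exact: cf|exact: cvg_cst].
have Dg s : t1 < s < t -> is_derive s 1 g (df s).
  move=> /andP[t1s _]; rewrite -[df _]subr0; apply: is_deriveB.
  by apply: Df; exact: le_lt_trans t1s.
have gg s : t1 < s < t -> - (c * rho) * g s <= df s.
  move=> /andP[/ltW t1s _].
  have s0 := le_trans t10 t1s.
  have := fd eps T _ HT s s0 (le_trans Tt1 t1s); rewrite eps0 eps1 => /(_ isT).
  apply: le_trans; have := ft0 s (le_trans t01 t1s); have /andP[_ fs1] := f1 s s0 => fs.
  have -> : - (c * rho) * g s = c * (rho * (1 - f s)) - 2 * eps.
    by rewrite /g; field; rewrite !gt_eqF.
  by rewrite lerD2r ler_pM2l//; nra.
have := exp_growth _ _ _ _ _ t1t cg Dg gg; rewrite mulNr expRN => H.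
have g1 : -2 <= g t1.
  have /andP[? _] := f1 t1 t10; have : 0 <= 2 * eps / (c * rho) by rewrite divr_ge0 ?mulr_ge0 ?ltW.
  by rewrite /g; lra.
have E8 : 8 / e ^+ 2 <= expR (c * rho * (t - t1)).
  apply: le_trans (expR_ge1Dx _); have : 8 / e ^+ 2 <= c * rho * (t - t1).
    by rewrite [leRHS]mulrC -ler_pdivrMr//; lra.
  by lra.
have iE : (expR (c * rho * (t - t1)))^-1 <= e ^+ 2 / 8.
  by rewrite -[leRHS]invrK lef_pV2 ?posrE ?invr_gt0 ?divr_gt0 ?expR_gt0// invf_div.
have gt : - (e ^+ 2 / 4) <= g t.
  have := expR_gt0 (c * rho * (t - t1)); rewrite -invr_gt0.
  move: (expR _)^-1 H iE => p H iE p0.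
  have : p * -2 <= p * g t1 by rewrite ler_pM2l.
  lra.
have eps2 : 2 * eps / (c * rho) <= e ^+ 2 / 4 by rewrite ler_pdivrMr//; lra.
rewrite -(@ler_pXn2r _ 2)// ?nnegrE ?enorm_ge0 ?(ltW e0)//.
have E : f t = 1 - enorm (x k t - u) ^+ 2 / 2 by rewrite enorm_distC -edot_dist.
by move: gt; rewrite /g; lra.
Unshelve. all: by end_near.
Qed.

Lemma solution_converges (theta : R) x : 0 < theta -> solution x ->
  (forall k (m : nat), (0 < k)%N ->
    ~ forall t, m%:R <= t -> antipodal_cap theta (x ^~ t) k) ->
  forall k, x k t @[t --> +oo] --> x o 0.
Proof.
move=> th0 sx ncap k.
suff H e : 0 < e -> \forall t \near +oo, enorm (x k t - x o 0) <= e.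
  apply/cvgrPdist_le => e e0; apply: filterS (H e e0) => t; apply: le_trans.
  (* The topology is that of the sup norm, which the Euclidean norm dominates. *)
  rewrite distrC {1}/Num.Def.normr /= mx_normrE.
  apply: bigmax_le => [|[i j] _ /=]; first exact: enorm_ge0.
  by rewrite (ord1 j); exact: coord_le_enorm.
(* Strong induction on the index: causality makes each token depend on the limits of all earlier
   ones. *)
elim/ltn_ind: (nat_of_ord k) {-2}k (erefl (nat_of_ord k)) e => m IH j jm e e0.
have [m0|m0] := posnP m; last first.
  have j0 : (0 < j)%N by rewrite jm.
  apply: (token_converges theta x j th0 sx j0) => // [p|i ij]; first exact: ncap.
  by apply: (IH i) => //; rewrite -jm.
have -> : j = o by apply: val_inj; rewrite /= jm.
apply/near_pinftyP; exists 0 => // t t0.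
by rewrite first_token_fixed// subrr enorm0 ltW.
Qed.

End convergence.

Theorem theorem4p1 (R : realType) (d n : nat) (d_ge2 : (2 <= d)%N)
    (n_ge1 : (1 <= n)%N) (beta : R) (Q K : 'M[R]_d) :
  {ae @sphere_volume R d n, forall X0 : n.-tuple (d.-tuple (measurableTypeR R)),
    (forall k : 'I_n, usphere (tuple_col (tnth X0 k))) ->
    forall x : 'I_n -> R -> 'cV[R]_d,
      causal_solution beta Q K x ->
      (forall k : 'I_n, x k 0 = tuple_col (tnth X0 k)) ->
      forall k : 'I_n, x k t @[t --> +oo] --> x (Ordinal n_ge1) 0}.
Proof.
have [theta th0 Hgraph] := antipodal_data_unif_graph (n := n) beta Q K.
(* Pairs of a token and an integer starting time are coded by naturals, making the exceptional set a
   countable union; codes of no pair and token 0 contribute the empty set. *)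
pose bad p := if (unpickle p : option ('I_n * nat)) is Some (k, m) then
  if (0 < k)%N then antipodal_data beta Q K theta m%:R k else set0 else set0.
apply: (@negligibleS _ _ _ _ (\bigcup_p bad p)); last first.
  apply: negligible_bigcup => p; rewrite /bad.
  case: unpickle => [[k m]|]; last exact: negligible_set0.
  case: ifPn => [k0|_]; last exact: negligible_set0.
  apply: (unif_graph_negligible _ k); last exact: Hgraph.
  by move=> v; exact: sphere_measure_set1.
(* By contraposition: for data outside the union, no solution keeps a later token in its cap from
   any integer time on. *)
move=> X0 /= H; apply: contrapT => nbad; apply: H => _ x sx x0.
apply: (solution_converges n_ge1 beta Q K theta x th0 sx) => k m k0 cap.
apply: nbad; exists (pickle (k, m)) => //; rewrite /bad pickleK k0.
by exists x.
Qed.
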